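(* Let $G$ be a finite group with identity $e$ and let $\omega: G\times G\times G\to\mathbb{C}^\times$ be a normalized $3$-cocycle with values of absolute value $1$. For $g,x,y\in G$ put $$\theta_{g}(x, y) = \frac{\omega(g, x, y)\,\omega(x, y, (xy)^{-1}gxy)}{\omega(x, x^{-1}gx, y)}.$$ For each conjugacy class $K$ of $G$ fix a representative $a\in K$ and, for every $g\in K$, an element $a_g\in G$ with $a=a_g g a_g^{-1}$ (for a class $L$ with representative $b$, these elements are denoted $b_h$, $h\in L$). Let $C(x)$ denote the centralizer of $x$ in $G$. Then the isomorphism classes of simple objects of $\mathcal{Z}(\mathsf{Vec}^{\omega^{-1}}G)$ correspond bijectively to triples $(K,a,\rho_a)$ with $K$ a conjugacy class of $G$ with its chosen representative $a$, and $\rho_a$ an irreducible $\theta_a$-projective representation of $C(a)$ (up to linear equivalence). Moreover, the entries of the $T$ and $S$ matrices of $\mathcal{Z}(\mathsf{Vec}^{\omega^{-1}}G)$ are given by $$T_{(K, a, \rho_a), (L, b, \psi_b)} = \delta_{K, L}\,\delta_{\rho_a, \psi_b}\,\frac{\chi_{\rho_a}(a)}{\chi_{\rho_a}(e)}$$ and $$S_{(K, a, \rho_a), (L, b, \psi_b)} = \frac{1}{|G|}\sum_{\substack{g \in K \\ h \in L \cap C(g)}} \left(\frac{\theta_a(a_g, h)\,\theta_a(a_gh, a_g^{-1})\,\theta_b(b_h, g)\,\theta_b(b_hg, b_h^{-1})}{\theta_g(a_g^{-1}, a_g)\,\theta_h(b_h^{-1}, b_h)}\right)^{*} \chi^*_{\rho_a}(a_gha_g^{-1})\,\chi^*_{\psi_b}(b_hgb_h^{-1}),$$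 where ${}^*$ denotes complex conjugation and $\chi_\rho(x)=\operatorname{tr}\rho(x)$.
   Context: All vector spaces are finite-dimensional over $\mathbb{C}$; $G$ acts trivially on $\mathbb{C}^\times$; a cocycle is normalized if it equals $1$ whenever one argument is $e$. Projective representations: for a $2$-cocycle $\beta$ on a group $H$, a $\beta$-projective representation is a pair $(V,\rho)$ with $\rho:H\to\operatorname{GL}(V)$ a function satisfying $\rho(g)\rho(h)=\beta(g,h)\rho(gh)$. It is irreducible if its only $H$-invariant subspaces are $0$ and $V$ (and $V\neq 0$). Two are linearly equivalent if they are intertwined by a linear isomorphism. The restriction of $\theta_a$ to $C(a)$ is a $2$-cocycle. The category $\mathsf{Vec}^{\nu}G$ (for a normalized $3$-cocycle $\nu$): objects are $G$-graded vector spaces $V=\bigoplus_g V_g$, morphisms are grading-preserving linear maps, $(V\otimes W)_g=\bigoplus_{hk=g}V_h\otimes W_k$, the unit is $\delta_e$ ($\mathbb{C}$ in degree $e$), unitors are trivial, and the associator $(U_g\otimes V_h)\otimes W_k\to U_g\otimes(V_h\otimes W_k)$ is multiplication by $\nu(g,h,k)$. Here $\nu=\omega^{-1}$. Write $\delta_g$ for $\mathbb{C}$ in degree $g$. The Drinfeld center $\mathcal{Z}(\mathcal{C})$: objects are pairs $(X,\alpha)$ with $\alpha_Y:Y\otimes X\to X\otimes Y$ a natural isomorphism (half braiding) satisfying $\alpha_{Y\otimes Y'} = a_{X,Y,Y'}\circ(\alpha_Y\otimes 1)\circ a_{Y,X,Y'}^{-1}\circ(1\otimes\alpha_{Y'})\circ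 a_{Y,Y',X}$, where $a$ is the associator. The tensor product half braiding is $(\alpha\otimes\beta)_Y=a_{X,X',Y}^{-1}\circ(1\otimes\beta_Y)\circ a_{X,Y,X'}\circ(\alpha_Y\otimes1)\circ a_{Y,X,X'}^{-1}$ for $(X,\alpha),(X',\beta)$. The braiding is $\sigma_{(X,\alpha),(Y,\beta)}=\beta_X: X\otimes Y\to Y\otimes X$. Rigid and pivotal structures are induced from $\mathsf{Vec}^{\omega^{-1}}G$ with its canonical spherical structure, i.e. the one for which the categorical dimension of every object is the dimension of the underlying vector space. Correspondence of simple objects: the triple attached to a simple object $(X,\alpha)$ consists of the conjugacy class $K$ on which the grading of $X$ is supported, its representative $a$, and the representation $\rho_a$ of $C(a)$ on $X_a$, where $\rho_a(x)$ is the restriction to $X_a$ of the map $X\to X$ obtained from $\alpha_{\delta_x}:\delta_x\otimes X\to X\otimes\delta_x$ by identifying both sides with the vector space $X$. Modular data: for simple objects $X,Y$, $S_{X,Y}=\frac{1}{|G|}\operatorname{Tr}(\sigma_{Y,X^*}\circ\sigma_{X^*,Y})$, where $\operatorname{Tr}$ is the categorical (quantum) trace. $T$ is the diagonal matrix whose entry at $X$ is the scalar by which the ribbon twist $\vartheta_X$ acts, where $\vartheta$ is the twist determined by the braiding and the spherical structure, so that $\vartheta_{X\otimes Y}=\sigma_{Y,X}\circ\sigma_{X,Y}\circ(\vartheta_X\otimes\vartheta_Y)$ and $\operatorname{Tr}(\vartheta_X)=\operatorname{Tr}(\sigma_{X,X})$. In $T$, $\delta_{\rho_a,\psi_b}$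 is $1$ if $\rho_a$ and $\psi_b$ are linearly equivalent (given $K=L$, $a=b$) and $0$ otherwise. *)

(* Defs.v *)
From HB Require Import structures.
From mathcomp Require Import all_boot all_order all_algebra all_fingroup.
Set Implicit Arguments.
Unset Strict Implicit.
Unset Printing Implicit Defensive.
Import Order.TTheory GRing.Theory Num.Theory.
Local Open Scope ring_scope.

Section TensorProduct.
Variable K : fieldType.
Implicit Types U V W X : vectType K.

(* V (x) W is modelled by matrices of coordinates in the library bases vbasis
   of V and W; the universal property is tlift_tens together with tens_ext. *)
Definition tensor V W : vectType K := 'M[K]_(\dim {:V}, \dim {:W}).

Definition tens V W (v : V) (w : W) : tensor V W :=
  \matrix_(i, j) (coord (vbasis {:V}) i v * coord (vbasis {:W}) j w).

Definition tlift V W X (f : V -> W -> X) : 'Hom(tensor V W, X) :=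
  linfun (fun t : tensor V W =>
    \sum_i \sum_j (t : 'M[K]_(_, _)) i j *: f (vbasis {:V})`_i (vbasis {:W})`_j).

Definition tmap V V' W W' (f : 'Hom(V, V')) (g : 'Hom(W, W')) :
    'Hom(tensor V W, tensor V' W') :=
  tlift (fun v w => tens (f v) (g w)).

Definition tassoc U V W : 'Hom(tensor (tensor U V) W, tensor U (tensor V W)) :=
  tlift (fun t w => tlift (fun u v => tens u (tens v w)) t).

Definition vtens V W (A : {vspace V}) (B : {vspace W}) : {vspace tensor V W} :=
  <<[seq tens v w | v <- vbasis A, w <- vbasis B]>>%VS.

Definition tr V (f : 'End(V)) : K :=
  \tr (passmx.mxof (vbasis {:V}) (vbasis {:V}) f).

Lemma linfunE V W (f : V -> W) : linear f -> linfun f =1 f.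
Proof.
move=> lf; pose F := GRing.isLinear.Build _ _ _ _ f lf.
by pose f' : {linear _ -> _} := HB.pack f F; exact: (lfunE f').
Qed.

Lemma tliftE V W X (f : V -> W -> X) (t : tensor V W) :
  tlift f t = \sum_i \sum_j (t : 'M[K]_(_, _)) i j *:
                f (vbasis {:V})`_i (vbasis {:W})`_j.
Proof.
rewrite /tlift linfunE // => a x y; rewrite scaler_sumr -big_split /=.
apply: eq_bigr => i _; rewrite scaler_sumr -big_split /=.
by apply: eq_bigr => j _; rewrite !mxE scalerDl scalerA.
Qed.

Lemma tlift_tens V W X (f : V -> W -> X) v w :
    (forall w', linear (f^~ w')) -> (forall v', linear (f v')) ->
  tlift f (tens v w) = f v w.
Proof.
move=> fl fr; rewrite tliftE.
rewrite [v in RHS](coord_basis (vbasisP {:V})) ?memvf //.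
rewrite -(linfunE (fl w)) linear_sum; apply: eq_bigr => i _.
rewrite linearZ /= (linfunE (fl w)).
rewrite [w in RHS](coord_basis (vbasisP {:W})) ?memvf //.
rewrite -(linfunE (fr _)) linear_sum scaler_sumr; apply: eq_bigr => j _.
by rewrite linearZ /= (linfunE (fr _)) mxE scalerA.
Qed.

Lemma tens_linear_l V W (w : W) : linear (fun v : V => tens v w).
Proof. by move=> a u v; apply/matrixP=> i j; rewrite !mxE linearP mulrDl mulrA. Qed.

Lemma tens_linear_r V W (v : V) : linear (fun w : W => tens v w).
Proof.
by move=> a u w; apply/matrixP=> i j; rewrite !mxE linearP mulrDr mulrCA.
Qed.

Lemma tens_suml V W (A : finType) (f : A -> V) (w : W) :
  tens (\sum_i f i) w = \sum_i tens (f i) w.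
Proof.
rewrite -(linfunE (@tens_linear_l V W w)) linear_sum.
by apply: eq_bigr => i _; exact: (linfunE (@tens_linear_l V W w)).
Qed.

Lemma tens_sumr V W (A : finType) (v : V) (f : A -> W) :
  tens v (\sum_i f i) = \sum_i tens v (f i).
Proof.
rewrite -(linfunE (@tens_linear_r V W v)) linear_sum.
by apply: eq_bigr => i _; exact: (linfunE (@tens_linear_r V W v)).
Qed.

Lemma tensE V W (t : tensor V W) :
  t = \sum_i \sum_j (t : 'M[K]_(_, _)) i j *:
        tens (vbasis {:V})`_i (vbasis {:W})`_j.
Proof.
rewrite [LHS]matrix_sum_delta; apply: eq_bigr => i _; apply: eq_bigr => j _.
congr (_ *: _); apply/matrixP=> k l; rewrite !mxE.
rewrite !coord_free ?(basis_free (vbasisP _)) //.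
by rewrite ![_ == k]eq_sym ![_ == l]eq_sym -natrM mulnb.
Qed.

Lemma tens_ext V W X (f g : 'Hom(tensor V W, X)) :
  (forall v w, f (tens v w) = g (tens v w)) -> f = g.
Proof.
move=> fg; apply/lfunP=> t; rewrite [t]tensE !linear_sum; apply: eq_bigr => i _.
by rewrite !linear_sum; apply: eq_bigr => j _; rewrite !linearZ /= fg.
Qed.

Lemma tmap_tens V V' W W' (f : 'Hom(V, V')) (g : 'Hom(W, W')) v w :
  tmap f g (tens v w) = tens (f v) (g w).
Proof.
apply: tlift_tens => [w'|v'] a x y.
  by rewrite linearP tens_linear_l.
by rewrite linearP tens_linear_r.
Qed.

Lemma tassoc_tens U V W (u : U) (v : V) (w : W) :
  tassoc U V W (tens (tens u v) w) = tens u (tens v w).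
Proof.
rewrite /tassoc tlift_tens => [|w' a x y|t a x y].
- rewrite tlift_tens // => [v'|u'] a x y; first by rewrite tens_linear_l.
  by rewrite tens_linear_l tens_linear_r.
- by rewrite linearP.
rewrite !tliftE scaler_sumr -big_split; apply: eq_bigr => i _ /=.
rewrite scaler_sumr -big_split; apply: eq_bigr => j _ /=.
by rewrite !tens_linear_r scalerDr !scalerA mulrC.
Qed.

Lemma mem_vtens V W (A : {vspace V}) (B : {vspace W}) v w :
  v \in A -> w \in B -> tens v w \in vtens A B.
Proof.
move=> Av Bw; rewrite (coord_vbasis Av) (coord_vbasis Bw).
rewrite -(linfunE (@tens_linear_l V W _)) linear_sum; apply: memv_suml => i _.
rewrite linearZ memvZ //= (linfunE (@tens_linear_l V W _)).
rewrite -(linfunE (@tens_linear_r V W _)) linear_sum; apply: memv_suml => j _.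
rewrite linearZ memvZ //= (linfunE (@tens_linear_r V W _)).
by apply/memv_span/allpairs_f; rewrite mem_nth ?size_tuple.
Qed.

Lemma vtens_eq V W X (A : {vspace V}) (B : {vspace W})
    (f g : 'Hom(tensor V W, X)) :
    {in A & B, forall v w, f (tens v w) = g (tens v w)} ->
  {in vtens A B, f =1 g}.
Proof.
move=> fg; apply/span_lfunP => _ /allpairsP[[v w] /= [Av Bw ->]].
by apply: fg; apply: vbasis_mem.
Qed.

End TensorProduct.

Section GradedSpaces.
Variables (K : fieldType) (gT : finGroupType).

Record gvect := GVect {
  gv_space :> vectType K;
  gv_comp : gT -> {vspace gv_space};
  gv_direct : directv (\sum_g gv_comp g);
  gv_total : (\sum_g gv_comp g)%VS = fullv }.

Definition gproj (V : gvect) (g : gT) : 'End(V) :=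
  sumv_pi_for (esym (gv_total V)) g.

Definition gmor (V W : gvect) (f : 'Hom(V, W)) : Prop :=
  forall g, (f @: gv_comp V g <= gv_comp W g)%VS.

Definition gisom (V W : gvect) (f : 'Hom(V, W)) : Prop :=
  gmor f /\ exists f' : 'Hom(W, V),
    [/\ gmor f', (f' \o f = \1)%VF & (f \o f' = \1)%VF].

Lemma gproj_mem (V : gvect) g v : gproj V g v \in gv_comp V g.
Proof. exact: memv_sum_pi. Qed.

Lemma gproj_sum (V : gvect) v : \sum_g gproj V g v = v.
Proof. by apply: (sumv_pi_sum (esym (gv_total V))); rewrite memvf. Qed.

Lemma gproj_id (V : gvect) g h v :
  v \in gv_comp V h -> gproj V g v = if g == h then v else 0.
Proof.
move=> Vv; have /directv_sum_unique dV := gv_direct V.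
have U0 k : true -> (if k == h then v else 0) \in gv_comp V k.
  by case: eqP => [->|_]; rewrite ?mem0v.
have := dV (fun k => gproj V k v) _ (fun k _ => gproj_mem k v) U0.
rewrite gproj_sum -big_mkcond big_pred1_eq eqxx => /esym/forall_inP H.
exact/eqP/H.
Qed.

Lemma grading_direct (V : vectType K) (U : gT -> {vspace V})
    (P : gT -> 'End(V)) :
    (forall g h v, v \in U h -> P g v = if g == h then v else 0) ->
  directv (\sum_g U g).
Proof.
move=> PU; apply/directv_sum_independent => us Uus s0 g _.
have := congr1 (P g) s0; rewrite linear0 linear_sum (bigD1 g) //= big1 ?addr0.
  by rewrite (PU g g) ?Uus // eqxx.
by move=> h /negPf hg; rewrite (PU g h) ?Uus // eq_sym hg.
Qed.

Lemma grading_total (V : vectType K) (U : gT -> {vspace V})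
    (P : gT -> 'End(V)) :
    (forall g v, P g v \in U g) -> (forall v, \sum_g P g v = v) ->
  (\sum_g U g)%VS = fullv.
Proof.
move=> PU sP; apply/vspaceP => v; rewrite memvf -(sP v).
by apply: memv_sumr => g _; exact: PU.
Qed.

Section Delta.
Variable x : gT.
Let V : vectType K := K^o.
Let U (g : gT) : {vspace V} := if g == x then fullv else 0%VS.
Let P (g : gT) : 'End(V) := if g == x then \1%VF else 0.

Fact delta_proj g h v : v \in U h -> P g v = if g == h then v else 0.
Proof.
rewrite /U /P.
case: eqP => [-> _|_]; last first.
  by rewrite memv0 => /eqP->; rewrite linear0 if_same.
by case: eqP; rewrite ?id_lfunE ?zero_lfunE.
Qed.

Fact delta_total : (\sum_g U g)%VS = fullv.
Proof.
apply: (@grading_total V U P) => [g v|v]; rewrite /U /P.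
  by case: eqP; rewrite ?memvf ?zero_lfunE ?mem0v.
by rewrite (bigD1 x) //= eqxx id_lfunE big1 ?addr0 // => g /negPf->; rewrite zero_lfunE.
Qed.

Definition delta : gvect := GVect (grading_direct delta_proj) delta_total.
End Delta.

Definition gunit : gvect := delta 1%g.

Section GTensor.
Variables V W : gvect.
Let U (g : gT) : {vspace tensor V W} :=
  (\sum_(p : gT * gT | (p.1 * p.2)%g == g)
     vtens (gv_comp V p.1) (gv_comp W p.2))%VS.
Let P (g : gT) : 'End(tensor V W) :=
  \sum_(p : gT * gT | (p.1 * p.2)%g == g) tmap (gproj V p.1) (gproj W p.2).

Let tprojE p q t : t \in vtens (gv_comp V q.1) (gv_comp W q.2) ->
  tmap (gproj V p.1) (gproj W p.2) t = if p == q then t else 0.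
Proof.
move=> tq; have -> : (if p == q then t else 0) =
    (if p == q then \1%VF else 0 : 'End(tensor V W)) t.
  by case: eqP; rewrite ?id_lfunE ?zero_lfunE.
apply: vtens_eq tq => v w Vv Ww; rewrite tmap_tens (gproj_id _ Vv) (gproj_id _ Ww).
case: p q {Vv Ww} => [a b] [c d] /=; rewrite xpair_eqE.
case: (a == c) => /=; last first.
  by rewrite zero_lfunE -(linfunE (@tens_linear_l K V W _)) linear0.
case: (b == d) => /=; first by rewrite id_lfunE.
by rewrite zero_lfunE -(linfunE (@tens_linear_r K V W _)) linear0.
Qed.

Fact gtensor_proj g h t : t \in U h -> P g t = if g == h then t else 0.
Proof.
move=> /memv_sumP[us Uus ->].
rewrite sum_lfunE; under eq_bigr do rewrite linear_sum.
rewrite exchange_big /=.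
have H q : (q.1 * q.2)%g == h -> \sum_(p : gT * gT | (p.1 * p.2)%g == g)
    tmap (gproj V p.1) (gproj W p.2) (us q) = if g == h then us q else 0.
  move=> qh; under eq_bigr => p _ do rewrite (tprojE _ (Uus q qh)).
  rewrite -big_mkcondr /=; case: eqP => [->|gh].
    rewrite (big_pred1 q) // => p /=.
    by case: (p =P q) => [->|]; rewrite ?qh ?andbF.
  rewrite big_pred0 // => p; apply/andP => -[/eqP pg /eqP pq].
  by apply: gh; rewrite -pg pq (eqP qh).
by rewrite (eq_bigr _ H); case: eqP => // _; rewrite big1.
Qed.

Fact gtensor_total : (\sum_g U g)%VS = fullv.
Proof.
apply: (@grading_total _ U P) => [g t|t].
  rewrite sum_lfunE; apply: memv_sumr => p _.
  rewrite [t]tensE !linear_sum; apply: memv_suml => i _.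
  rewrite !linear_sum; apply: memv_suml => j _.
  by rewrite linearZ memvZ //= tmap_tens mem_vtens ?gproj_mem.
have -> : \sum_g P g t = (\sum_g P g) t by rewrite sum_lfunE.
rewrite -[RHS]id_lfunE; congr (fun_of_lfun _ t).
rewrite /P -(@partition_big _ _ _ _ _ _ xpredT (fun p => (p.1 * p.2)%g)
              xpredT (fun p => tmap (gproj V p.1) (gproj W p.2))) //=.
rewrite -(pair_big xpredT xpredT
           (fun p q : gT => tmap (gproj V p) (gproj W q))) /=.
apply: tens_ext => v w; rewrite id_lfunE sum_lfunE.
transitivity (\sum_p tens (gproj V p v) w).
  apply: eq_bigr => p _; rewrite sum_lfunE; under eq_bigr do rewrite tmap_tens.
  by rewrite -tens_sumr gproj_sum.
by rewrite -tens_suml gproj_sum.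
Qed.

Definition gtensor : gvect := GVect (grading_direct gtensor_proj) gtensor_total.
End GTensor.

Section Dual.
Variable V : gvect.
Let D : vectType K := 'Hom(V, K^o).
Let P (g : gT) : 'End(D) := linfun (fun phi : D => (phi \o gproj V g^-1%g)%VF : D).

(* Degree g of the dual: the functionals factoring through the projection onto
   V_{g^-1}, that is (see mem_gdual), those vanishing on V_h for h <> g^-1. *)
Let U (g : gT) : {vspace D} := limg (P g).

Let PE g phi v : P g phi v = phi (gproj V g^-1%g v).
Proof.
rewrite /P linfunE ?comp_lfunE // => a f h; apply/lfunP => u.
by rewrite !(comp_lfunE, add_lfunE, scale_lfunE).
Qed.

Fact gdual_proj g h phi : phi \in U h -> P g phi = if g == h then phi else 0.
Proof.
move=> /memv_imgP[{}phi _ ->].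
apply/lfunP => v; rewrite !PE (gproj_id _ (gproj_mem _ _)).
rewrite (inj_eq invg_inj) eq_sym; case: eqP => [->|_]; rewrite ?PE //.
by rewrite linear0 zero_lfunE.
Qed.

Fact gdual_total : (\sum_g U g)%VS = fullv.
Proof.
apply: (@grading_total D U P) => [g phi|phi]; first exact: memv_img (memvf _).
apply/lfunP => v; rewrite sum_lfunE -[v in RHS]gproj_sum linear_sum.
rewrite [RHS](reindex_inj invg_inj); apply: eq_bigr => g _; exact: PE.
Qed.

Definition gdual : gvect := GVect (grading_direct gdual_proj) gdual_total.

Lemma mem_gdual (phi : 'Hom(V, K^o)) g :
  reflect (forall h v, h != g^-1%g -> v \in gv_comp V h -> phi v = 0)
          (phi \in gv_comp gdual g).
Proof.
apply: (iffP idP) => [/memv_imgP[psi _ ->] h v hg Vv|phi0].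
  by rewrite PE (gproj_id _ Vv) eq_sym (negPf hg) linear0.
apply/memv_imgP; exists phi; rewrite ?memvf //; apply/lfunP => v.
rewrite PE -[v in LHS]gproj_sum linear_sum (bigD1 g^-1%g) //= big1 ?addr0 //.
by move=> h hg; apply: phi0 hg (gproj_mem _ _).
Qed.

End Dual.

End GradedSpaces.

Notation "V ⊗ W" := (gtensor V W) (at level 40, left associativity).
Notation "f ⊠ g" := (tmap f g) (at level 40, left associativity).

(* The category Vec^nu G.  Its associator is multiplication by nu g h k on
   (U_g (x) V_h) (x) W_k; its unitors are the evident linear maps. *)
Section VecNuG.
Variables (K : fieldType) (gT : finGroupType) (nu : gT -> gT -> gT -> K).
Notation gvect := (gvect K gT).
Notation I := (gunit K gT).
Implicit Types U V W X Y : gvect.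

Definition assoc U V W : 'Hom((U ⊗ V) ⊗ W, U ⊗ (V ⊗ W)) :=
  \sum_g \sum_h \sum_k nu g h k *:
    (tassoc U V W \o ((gproj U g ⊠ gproj V h) ⊠ gproj W k))%VF.

(* The next four maps only use that the one-dimensional factor is K. *)
Definition lunit (V : vectType K) : 'Hom(tensor K^o V, V) :=
  tlift (fun (c : K^o) v => c *: v).
Definition lunit_inv (V : vectType K) : 'Hom(V, tensor K^o V) :=
  linfun (fun v => tens (1 : K^o) v).
Definition runit (V : vectType K) : 'Hom(tensor V K^o, V) :=
  tlift (fun v (c : K^o) => c *: v).
Definition runit_inv (V : vectType K) : 'Hom(V, tensor V K^o) :=
  linfun (fun v => tens v (1 : K^o)).

(* Left duals.  With the standard coevaluation, the zigzag identities force the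
   factor nu(g, g^-1, g)^-1 in the evaluation on (V_g)^* (x) V_g. *)
Definition ev V : 'Hom(gdual V ⊗ V, I) :=
  tlift (fun (phi : 'Hom(V, K^o)) (v : V) =>
    \sum_g (nu g g^-1%g g)^-1 *: phi (gproj V g v)).

Definition coev V : 'Hom(I, V ⊗ gdual V) :=
  linfun (fun c : K^o => c *:
    \sum_(i < \dim {:V}) tens (vbasis {:V})`_i
      (linfun (fun v : V => coord (vbasis {:V}) i v : K^o))).

(* The pivotal structure for which the categorical dimension of every object is
   the dimension of the underlying space: the factor makes
   ev_{V^*} o (piv_V (x) 1) the plain pairing v (x) phi |-> phi v. *)
Definition piv V : 'Hom(V, gdual (gdual V)) :=
  linfun (fun v : V => linfun (fun phi : 'Hom(V, K^o) =>
    \sum_g nu g^-1%g g g^-1%g *: phi (gproj V g v)) : 'Hom(gdual V, K^o)).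

Definition ev' V : 'Hom(V ⊗ gdual V, I) :=
  (ev (gdual V) \o (piv V ⊠ \1))%VF.

Definition cattr V (f : 'End(V)) : K :=
  (ev' V \o (f ⊠ \1) \o coev V)%VF (1 : K^o).

Record zobj := ZObj {
  z_obj :> gvect;
  z_hb : forall Y, 'Hom(Y ⊗ z_obj, z_obj ⊗ Y);
  z_hb_isom : forall Y, gisom (z_hb Y);
  z_hb_nat : forall Y Y' (f : 'Hom(Y, Y')), gmor f ->
    ((\1 ⊠ f) \o z_hb Y = z_hb Y' \o (f ⊠ \1))%VF;
  z_hb_tensor : forall Y Y',
    z_hb (Y ⊗ Y') =
      (assoc z_obj Y Y' \o (z_hb Y ⊠ \1) \o (assoc Y z_obj Y')^-1
        \o (\1 ⊠ z_hb Y') \o assoc Y Y' z_obj)%VF }.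

Definition zmor (X Y : zobj) (f : 'Hom(X, Y)) : Prop :=
  gmor f /\
  forall Z : gvect, ((f ⊠ \1) \o z_hb X Z = z_hb Y Z \o (\1 ⊠ f))%VF.

Definition zisom (X Y : zobj) (f : 'Hom(X, Y)) : Prop :=
  zmor f /\ exists f' : 'Hom(Y, X),
    [/\ zmor f', (f' \o f = \1)%VF & (f \o f' = \1)%VF].

Definition ziso (X Y : zobj) : Prop := exists f : 'Hom(X, Y), zisom f.

Definition zmono (X Y : zobj) (f : 'Hom(X, Y)) : Prop :=
  forall (Z : zobj) (g h : 'Hom(Z, X)), zmor g -> zmor h ->
    (f \o g = f \o h)%VF -> g = h.

Definition zsimple (X : zobj) : Prop :=
  (\1%VF : 'End(X)) <> 0 /\
  forall (Y : zobj) (f : 'Hom(Y, X)), zmor f -> zmono f -> f = 0 \/ zisom f.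

Definition braiding (X Y : zobj) : 'Hom(X ⊗ Y, Y ⊗ X) := z_hb Y X.

(* The half braiding of the dual X^* is the one for which ev and coev are
   morphisms of the center; this says that its inverse is the mate of that
   of X. *)
Definition dual_hb_inv (X : zobj) (Y : gvect) :
    'Hom(gdual X ⊗ Y, Y ⊗ gdual X) :=
  ((lunit Y ⊠ \1)
   \o ((ev X ⊠ \1) ⊠ \1)
   \o ((assoc (gdual X) X Y)^-1 ⊠ \1)
   \o ((\1 ⊠ z_hb X Y) ⊠ \1)
   \o (assoc (gdual X) Y X ⊠ \1)
   \o (assoc (gdual X ⊗ Y) X (gdual X))^-1
   \o (\1 ⊠ coev X)
   \o runit_inv (gdual X ⊗ Y))%VF.

Definition dual_hb (X : zobj) (Y : gvect) : 'Hom(Y ⊗ gdual X, gdual X ⊗ Y) :=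
  (dual_hb_inv X Y)^-1%VF.

(* Both braidings are half braidings: sigma_{X^*,Y} is that of Y at X^*, and
   sigma_{Y,X^*} is that of X^* at Y. *)
Definition Smatrix (X Y : zobj) : K :=
  #|gT|%:R^-1 *
  cattr (V := gdual X ⊗ Y) (dual_hb X Y \o z_hb Y (gdual X))%VF.

(* The twist is the right partial trace of the self-braiding. *)
Definition twist (X : zobj) : 'End(X) :=
  (runit X
   \o (\1 ⊠ ev' X)
   \o assoc X X (gdual X)
   \o (braiding X X ⊠ \1)
   \o (assoc X X (gdual X))^-1
   \o (\1 ⊠ coev X)
   \o runit_inv X)%VF.

(* c is the entry of the diagonal matrix T at (X, Y), rows and columns being
   indexed by isomorphism classes. *)
Definition is_Tentry (X Y : zobj) (c : K) : Prop :=
  (ziso X Y -> twist X = c *: \1%VF) /\ (~ ziso X Y -> c = 0).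

(* alpha_{delta_x}, both sides being identified with X *)
Definition phi (X : zobj) (x : gT) : 'End(X) :=
  (runit X \o z_hb X (delta K x) \o lunit_inv X)%VF.

Definition zrep (X : zobj) (a x : gT) : 'End(subvs_of (gv_comp X a)) :=
  linfun (fun v => vsproj (gv_comp X a) (phi X x (vsval v))).

Definition zsupported (X : zobj) (A : {set gT}) : Prop :=
  forall g, g \notin A -> gv_comp X g = 0%VS.

End VecNuG.

Section ProjectiveRepresentations.
Variables (K : fieldType) (gT : finGroupType).

(* Only the values of beta and of representations on H matter. *)
Definition proj_repr (H : {set gT}) (beta : gT -> gT -> K)
    (V : vectType K) (rho : gT -> 'End(V)) : Prop :=
  (forall x, x \in H -> exists r, (r \o rho x = \1)%VF /\ (rho x \o r = \1)%VF) /\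
  {in H &, forall x y, (rho x \o rho y)%VF = beta x y *: rho (x * y)%g}.

Definition proj_irr (H : {set gT}) (V : vectType K) (rho : gT -> 'End(V)) : Prop :=
  {:V}%VS <> 0%VS /\
  forall U : {vspace V}, (forall x, x \in H -> (rho x @: U <= U)%VS) ->
    U = 0%VS \/ U = fullv.

Definition proj_equiv (H : {set gT}) (V W : vectType K)
    (rho : gT -> 'End(V)) (psi : gT -> 'End(W)) : Prop :=
  exists (f : 'Hom(V, W)) (f' : 'Hom(W, V)),
    [/\ (f' \o f = \1)%VF, (f \o f' = \1)%VF
      & forall x, x \in H -> (f \o rho x = psi x \o f)%VF].

Definition character (V : vectType K) (rho : gT -> 'End(V)) (x : gT) : K :=
  tr (rho x).

Definition cocycle3 (w : gT -> gT -> gT -> K) : Prop :=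
  (forall x y z, w x y z != 0) /\
  forall x y z t, w y z t * w x (y * z)%g t * w x y z =
                  w (x * y)%g z t * w x y (z * t)%g.

Definition normalized3 (w : gT -> gT -> gT -> K) : Prop :=
  forall x y, [/\ w 1%g x y = 1, w x 1%g y = 1 & w x y 1%g = 1].

Definition theta (w : gT -> gT -> gT -> K) (g x y : gT) : K :=
  w g x y * w x y ((x * y)^-1 * g * x * y)%g / w x (x^-1 * g * x)%g y.

Definition inv3 (w : gT -> gT -> gT -> K) (x y z : gT) : K := (w x y z)^-1.

(* (K, a, rho_a); the representative a is that of the class K *)
Record triple := Triple {
  t_class : {set gT};
  t_space : vectType K;
  t_rep : gT -> 'End(t_space) }.

Variable a : {set gT} -> gT.

Definition is_triple (w : gT -> gT -> gT -> K) (t : triple) : Prop :=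
  let H := 'C[a (t_class t)]%g in
  [/\ t_class t \in classes [set: gT],
      proj_repr H (theta w (a (t_class t))) (t_rep t)
    & proj_irr H (t_rep t)].

Definition triple_equiv (t u : triple) : Prop :=
  t_class t = t_class u /\
  proj_equiv 'C[a (t_class t)]%g (t_rep t) (t_rep u).

(* the triple attached to a simple object of the center, up to equivalence *)
Definition attached (nu : gT -> gT -> gT -> K) (X : zobj nu) (t : triple) : Prop :=
  zsupported X (t_class t) /\
  proj_equiv 'C[a (t_class t)]%g (zrep X (a (t_class t))) (t_rep t).

End ProjectiveRepresentations.

(* Main.v *)
Require Import Defs.
From HB Require Import structures.
From mathcomp Require Import all_boot all_order all_algebra all_fingroup.
From mathcomp Require Import spectral ring.
From mathcomp Require Import complex boolp reals.
Set Implicit Arguments.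
Unset Strict Implicit.
Unset Printing Implicit Defensive.
Import Order.TTheory GRing.Theory Num.Theory.
Local Open Scope ring_scope.

(** An object of the center of Vec^nu G, with nu = omega^-1, is the same thing
    as a graded space X with a twisted action of G.  Naturality determines a
    half braiding from the operators phi_x that it induces on the
    one-dimensional objects delta_x; phi_x maps X_g to X_(x g x^-1), and the
    hexagon for delta_x and delta_y says that phi_x phi_y differs from phi_(xy),
    on vectors ending in degree g, by exactly the scalar theta_g(x, y)
    ([phi_action], and conversely [zobj_of_action]).  Morphisms of the center
    are the graded maps commuting with the phi_x ([zmorP]).

    Everything then happens on this side.  Subobjects are the graded subspaces
    stable under the phi_x ([zsimpleP]).  The sum of the X_g over a conjugacy
    class is stable, so a simple object lives on one class; there the operators
    phi_x carry the component at a to all the others, so that stable subspaces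
    correspond to invariant subspaces of X_a under the centralizer C(a)
    ([zsimple_irr]).  Every theta_a-projective representation of C(a) occurs as
    some X_a, by a twisted induction ([ind_zobj]), and an intertwiner between
    X_a and Y_a extends by averaging to a morphism of the center, which Schur's
    lemma makes an isomorphism ([zrep_zmor], [ziso_zrep]).

    The twist acts on X_g as phi_g ([twist_homog]); it is an endomorphism of
    X in the center, hence a scalar on a simple object, which the trace on X_a
    identifies.

    For S, the double braiding on X^* (x) Y permutes the products of components
    X_g^* (x) Y_h, and only those with g h = h g contribute to the trace.  Such a
    pair contributes the trace of phi_(h^-1) on X_g times that of phi_(g^-1) on
    Y_h, up to values of omega that come from the associators and the
    evaluation; by the cocycle identity these are the values of theta that turn
    phi_(h^-1) and phi_(g^-1) into inverses of phi_h and phi_g ([mate_comm],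
    [cattr_braiding]).  As omega has absolute value 1, the operators are unitary
    for a suitable form, and inverting them conjugates the traces
    ([proj_repr_trV], [Smatrix_ctr]).  Finally phi_c with a = c g c^-1 moves the
    trace from X_g to X_a; the ratio of thetas in the formula for S is the
    scalar by which this conjugation fails to be strict ([ctr_conj]). *)

(** * Linear algebra of tensor products and traces *)

Section Tensors.
Variable K : fieldType.
Implicit Types U V W X : vectType K.

Lemma tens0l V W (w : W) : tens (0 : V) w = 0.
Proof. by rewrite -(linfunE (@tens_linear_l K V W w)) linear0. Qed.

Lemma tens0r V W (v : V) : tens v (0 : W) = 0.
Proof. by rewrite -(linfunE (@tens_linear_r K V W v)) linear0. Qed.

Lemma tensZl V W k (v : V) (w : W) : tens (k *: v) w = k *: tens v w.
Proof. by rewrite -!(linfunE (@tens_linear_l K V W w)) linearZ. Qed.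

Lemma tensZr V W k (v : V) (w : W) : tens v (k *: w) = k *: tens v w.
Proof. by rewrite -!(linfunE (@tens_linear_r K V W v)) linearZ. Qed.

Lemma dim_tensor V W : \dim {:tensor V W} = (\dim {:V} * \dim {:W})%N.
Proof. by rewrite [LHS]dimvf dim_matrix. Qed.

Lemma tens3_ext U V W X (f g : 'Hom(tensor (tensor U V) W, X)) :
  (forall u v w, f (tens (tens u v) w) = g (tens (tens u v) w)) -> f = g.
Proof.
move=> fg; apply: tens_ext => t w.
pose L (h : 'Hom(tensor (tensor U V) W, X)) :=
  (h \o linfun (fun t => tens t w))%VF : 'Hom(tensor U V, X).
have LE h s : L h s = h (tens s w).
  by rewrite comp_lfunE (linfunE (@tens_linear_l K (tensor U V) W w)).
rewrite -!LE; congr (fun_of_lfun _ t); apply: tens_ext => u v.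
by rewrite !LE fg.
Qed.

Lemma onto_lfunK V W (f : 'Hom(V, W)) :
    \dim {:V} = \dim {:W} -> (forall w, exists v, f v = w) ->
  cancel f (f^-1)%VF /\ cancel (f^-1)%VF f.
Proof.
move=> dVW onto; have fT : limg f = fullv.
  apply/vspaceP => w; rewrite memvf; have [v <-] := onto w.
  by rewrite memv_img ?memvf.
split; last by move=> w; rewrite limg_lfunVK // fT memvf.
apply: lker0_lfunK; rewrite -dimv_eq0.
have := limg_ker_dim f fullv; rewrite fT -dVW capfv -[RHS]add0n.
by move=> /addIn ->.
Qed.

(** The inverse of a surjective map may be computed on any preimage; this is
    how inverse associators and inverse half braidings are evaluated. *)
Lemma onto_tens_lfunK V W X (f : 'Hom(X, tensor V W)) :
    \dim {:X} = (\dim {:V} * \dim {:W})%N ->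
    (forall v w, exists x, f x = tens v w) ->
  cancel f (f^-1)%VF /\ cancel (f^-1)%VF f.
Proof.
move=> dX onto; apply: onto_lfunK => [|t]; first by rewrite dim_tensor.
suff /memv_imgP[x _ ->] : t \in limg f by exists x.
rewrite [t]tensE; apply: memv_suml => i _; apply: memv_suml => j _.
by apply: memvZ; have [x <-] := onto (vbasis {:V})`_i (vbasis {:W})`_j;
  rewrite memv_img ?memvf.
Qed.

End Tensors.

Section Trace.
Import passmx.
Variable K : fieldType.
Implicit Types U V W : vectType K.

Lemma trE V (f : 'End(V)) :
  tr f = \sum_i coord (vbasis {:V}) i (f (vbasis {:V})`_i).
Proof.
by apply: eq_bigr => i _; rewrite !mxE /= vecof_delta.
Qed.

(** The distinguished bases of a tensor product and of a dual space are
    unrelated to those of the factors; this lemma allows the tensors of basis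
    vectors and the coordinate forms to be used instead. *)
Lemma tr_frame V (I : finType) (b : I -> V) (p : I -> 'Hom(V, K^o))
    (f : 'End(V)) :
  (forall v, v = \sum_k p k v *: b k) -> tr f = \sum_k p k (f (b k)).
Proof.
move=> pb; rewrite trE.
under eq_bigr => i _ do
  rewrite [X in f X]pb (linear_sum f) linear_sum /=.
rewrite exchange_big /=; apply: eq_bigr => k _.
rewrite [f (b k) in RHS](coord_basis (vbasisP {:V})) ?memvf // linear_sum /=.
by apply: eq_bigr => i _; rewrite !linearZ /= mulrC.
Qed.

Lemma trC V W (f : 'Hom(V, W)) (g : 'Hom(W, V)) :
  tr (f \o g)%VF = tr (g \o f)%VF.
Proof.
rewrite !trE.
have E (A B : vectType K) (h : 'Hom(A, B)) (k : 'Hom(B, A)) i :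
    coord (vbasis {:A}) i ((k \o h)%VF (vbasis {:A})`_i) =
    \sum_j coord (vbasis {:B}) j (h (vbasis {:A})`_i) *
           coord (vbasis {:A}) i (k (vbasis {:B})`_j).
  rewrite comp_lfunE.
  rewrite [h _ in LHS](coord_basis (vbasisP {:B})) ?memvf // !linear_sum /=.
  by apply: eq_bigr => j _; rewrite !linearZ.
under eq_bigr do rewrite E; under [RHS]eq_bigr do rewrite E.
rewrite exchange_big; apply: eq_bigr => i _; apply: eq_bigr => j _.
exact: mulrC.
Qed.

Lemma trZ V k (f : 'End(V)) : tr (k *: f) = k * tr f.
Proof. by rewrite /tr linearZ /= mxtraceZ. Qed.

Lemma tr_sum V (I : finType) (P : pred I) (f : I -> 'End(V)) :
  tr (\sum_(i | P i) f i) = \sum_(i | P i) tr (f i).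
Proof. by rewrite /tr !linear_sum. Qed.

Lemma tr0 V : tr (0 : 'End(V)) = 0.
Proof. by rewrite /tr !linear0. Qed.

Lemma tr1 V : tr (\1%VF : 'End(V)) = (\dim {:V})%:R.
Proof.
rewrite trE (eq_bigr (fun=> 1)) ?sumr_const ?card_ord // => i _.
by rewrite id_lfunE coord_free ?(basis_free (vbasisP _)) // eqxx.
Qed.

Lemma tr_tmap V W (f : 'End(V)) (g : 'End(W)) : tr (tmap f g) = tr f * tr g.
Proof.
pose e (i : 'I_(\dim {:V})) (j : 'I_(\dim {:W})) : tensor V W :=
  tens (vbasis {:V})`_i (vbasis {:W})`_j.
pose p i j : 'Hom(tensor V W, K^o) :=
  linfun (fun t : tensor V W => (t : 'M[K]_(_, _)) i j : K^o).
have pE i j t : p i j t = (t : 'M[K]_(_, _)) i j.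
  by rewrite linfunE // => k s u; rewrite !mxE.
rewrite (@tr_frame _ _ (fun ij => e ij.1 ij.2) (fun ij => p ij.1 ij.2)).
  rewrite -(pair_bigA _ (fun i j => p i j (tmap f g (e i j)))) /=.
  rewrite !trE mulr_suml; apply: eq_bigr => i _; rewrite mulr_sumr.
  by apply: eq_bigr => j _; rewrite pE tmap_tens mxE.
move=> t; rewrite -(pair_bigA _ (fun i j => p i j t *: e i j)) /=.
rewrite [LHS]tensE; apply: eq_bigr => i _; apply: eq_bigr => j _.
by rewrite pE.
Qed.

Definition dual_map V (f : 'End(V)) : 'End('Hom(V, K^o)) :=
  linfun (fun l : 'Hom(V, K^o) => (l \o f)%VF).

Lemma dual_mapE V (f : 'End(V)) l : dual_map f l = (l \o f)%VF.
Proof.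
rewrite /dual_map linfunE // => k l1 l2.
by rewrite comp_lfunDl -comp_lfunZl.
Qed.

Definition dual_basis V i : 'Hom(V, K^o) :=
  linfun (fun v : V => coord (vbasis {:V}) i v : K^o).
Arguments dual_basis : clear implicits.

Lemma dual_basisE V i (v : V) : dual_basis V i v = coord (vbasis {:V}) i v.
Proof. by rewrite linfunE // => k u w; rewrite linearP. Qed.

Lemma dual_expand V (l : 'Hom(V, K^o)) :
  l = \sum_(i < \dim {:V}) l (vbasis {:V})`_i *: dual_basis V i.
Proof.
apply/lfunP => v.
rewrite sum_lfunE [v in LHS](coord_basis (vbasisP {:V})) ?memvf // linear_sum.
by apply: eq_bigr => i _; rewrite linearZ scale_lfunE dual_basisE [RHS]mulrC.
Qed.

Lemma tr_dual_map V (f : 'End(V)) : tr (dual_map f) = tr f.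
Proof.
pose p i : 'Hom('Hom(V, K^o), K^o) :=
  linfun (fun l : 'Hom(V, K^o) => l (vbasis {:V})`_i : K^o).
have pE i l : p i l = l (vbasis {:V})`_i.
  by rewrite linfunE // => k l1 l2; rewrite add_lfunE scale_lfunE.
rewrite (@tr_frame _ _ (dual_basis V) p) => [|l].
  rewrite trE; apply: eq_bigr => i _.
  by rewrite pE dual_mapE comp_lfunE dual_basisE.
rewrite [LHS]dual_expand; apply: eq_bigr => i _.
by rewrite pE.
Qed.

(** Both sides are the image of f under the isomorphism of End(V) with
    V (x) V^*: an operator may be moved across the canonical element. *)
Lemma frame_dual_map V (f : 'End(V)) :
  \sum_(i < \dim {:V}) tens (f (vbasis {:V})`_i) (dual_basis V i) =
  \sum_(i < \dim {:V}) tens (vbasis {:V})`_i (dual_basis V i \o f)%VF.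
Proof.
have fE (i : 'I_(\dim {:V})) : f (vbasis {:V})`_i = \sum_j
    coord (vbasis {:V}) j (f (vbasis {:V})`_i) *: (vbasis {:V})`_j.
  by apply: (coord_basis (vbasisP {:V})); rewrite memvf.
have dE (j : 'I_(\dim {:V})) : (dual_basis V j \o f)%VF = \sum_(i < \dim {:V})
    coord (vbasis {:V}) j (f (vbasis {:V})`_i) *: dual_basis V i.
  apply/lfunP => v; rewrite comp_lfunE dual_basisE sum_lfunE.
  rewrite [v in LHS](coord_basis (vbasisP {:V})) ?memvf // !linear_sum /=.
  apply: eq_bigr => i _.
  by rewrite !linearZ /= scale_lfunE dual_basisE mulrC.
under eq_bigr do rewrite fE tens_suml.
under [RHS]eq_bigr do rewrite dE tens_sumr.
rewrite exchange_big; apply: eq_bigr => j _; apply: eq_bigr => i _.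
by rewrite tensZl tensZr.
Qed.

End Trace.
Arguments dual_basis {K} V i.

(** * Eigenvectors and invariant Hermitian forms *)

Section ClosedField.
Import passmx.
Variable C : numClosedFieldType.

Lemma lfun_eigenvector (V : vectType C) (f : 'End(V)) :
  {:V}%VS != 0%VS -> exists k (v : V), v != 0 /\ f v = k *: v.
Proof.
rewrite -dimv_eq0 -lt0n => V0.
have bV := vbasisP {:V}.
have [k /eigenvalueP[u uk u0]] := eigenvalue_closed
  (mxof (vbasis {:V}) (vbasis {:V}) f) V0.
exists k, (vecof (vbasis {:V}) u).
split; first by rewrite vecof_eq0.
by rewrite (hom_vecof _ bV) uk linearZ.
Qed.

Let ct m n (A : 'M[C]_(m, n)) : 'M[C]_(n, m) := (map_mx Num.conj A)^T.

Let ctM m n p (A : 'M[C]_(m, n)) (B : 'M_(n, p)) : ct (A *m B) = ct B *m ct A.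
Proof. by rewrite /ct map_mxM trmx_mul. Qed.

Let ctZ m n k (A : 'M[C]_(m, n)) : ct (k *: A) = k^* *: ct A.
Proof. by apply/matrixP => i j; rewrite !mxE rmorphM. Qed.

Let ct_norm n (v : 'rV[C]_n) : (v *m ct v) 0 0 = \sum_j `|v 0 j| ^+ 2.
Proof. by rewrite mxE; apply: eq_bigr => j _; rewrite !mxE normCK. Qed.

(** Averaging a positive definite Hermitian form over the group gives one that
    every rho x preserves, because the cocycle has absolute value 1.  So rho x
    is unitary for the averaged form: its inverse is conjugate to its adjoint. *)
Lemma proj_repr_trV (gT : finGroupType) (H : {group gT})
    (beta : gT -> gT -> C) (V : vectType C) (rho : gT -> 'End(V))
    (x : gT) (s : 'End(V)) :
    (forall x y, `|beta x y| = 1) -> proj_repr H beta rho ->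
    x \in H -> (rho x \o s = \1)%VF ->
  tr s = (tr (rho x))^*.
Proof.
move=> beta1 [rho_inv rhoM] Hx rs.
have bV := vbasisP {:V}; have fV := basis_free bV.
pose M (f : 'End(V)) := mxof (vbasis {:V}) (vbasis {:V}) f.
have MM f g : M (f \o g)%VF = M g *m M f by apply: mxof_comp.
have M1 : M \1%VF = 1%:M by apply: mxof1.
have MZ k f : M (k *: f) = k *: M f by rewrite /M linearZ.
(* F is the Gram matrix of the averaged form; operators act on row vectors. *)
pose F := \sum_(y in H) M (rho y) *m ct (M (rho y)).
have rhoF : M (rho x) *m F *m ct (M (rho x)) = F.
  rewrite /F mulmx_sumr mulmx_suml.
  rewrite [RHS](reindex_inj (mulIg x)) /=.
  apply: eq_big => [y|y Hy]; first by rewrite groupMr.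
  rewrite !mulmxA -mulmxA -ctM -MM rhoM // MZ ctZ -scalemxAl -scalemxAr scalerA.
  by rewrite -normCK beta1 expr1n scale1r.
have Funit : F \in unitmx.
  rewrite -row_free_unit -kermx_eq0; apply/eqP/row_matrixP => i.
  rewrite row0; set v := row i _.
  have vF : v *m F = 0 by apply/sub_kermxP; rewrite row_sub.
  have: (v *m F *m ct v) 0 0 == 0 by rewrite vF mul0mx mxE.
  have -> : (v *m F *m ct v) 0 0 =
      \sum_(y in H) \sum_j `|(v *m M (rho y)) 0 j| ^+ 2.
    rewrite mulmx_sumr mulmx_suml summxE; apply: eq_bigr => y _.
    by rewrite -ct_norm ctM !mulmxA.
  rewrite psumr_eq0 => [/allP/(_ 1%g)|y _]; last first.
    by apply: sumr_ge0 => j _; rewrite exprn_ge0.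
  rewrite mem_index_enum group1 => /(_ isT).
  rewrite psumr_eq0 => [/allP v1|j _]; last by rewrite exprn_ge0.
  have {}v1 : v *m M (rho 1%g) = 0.
    apply/rowP => j; rewrite [RHS]mxE.
    have := v1 j; rewrite mem_index_enum => /(_ isT) /=.
    by rewrite expf_eq0 normr_eq0 => /eqP.
  have [r [r1 _]] := rho_inv 1%g (group1 H).
  by rewrite -[v]mulmx1 -M1 -r1 MM mulmxA v1 mul0mx.
have sr : M s *m M (rho x) = 1%:M by rewrite -MM rs M1.
rewrite /tr -/(M _) -/(M _).
have -> : (\tr (M (rho x)))^* = \tr (ct (M (rho x))).
  rewrite mxtrace_tr /mxtrace rmorph_sum; apply: eq_bigr => i _.
  by rewrite [RHS]mxE.
have -> : ct (M (rho x)) = invmx F *m (M s *m F).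
  have -> : M s *m F = F *m ct (M (rho x)).
    by rewrite -[in LHS]rhoF !mulmxA sr mul1mx.
  by rewrite mulKmx.
by rewrite mxtrace_mulC mulmxK.
Qed.

End ClosedField.

(** * Homogeneous elements of graded spaces *)

Section Homogeneous.
Variables (K : fieldType) (gT : finGroupType).
Notation gvect := (gvect K gT).
Implicit Types U V W X Y : gvect.

Lemma gproj_fix V g v : v \in gv_comp V g -> gproj V g v = v.
Proof. by move/(gproj_id g)->; rewrite eqxx. Qed.

Lemma homogP V g v : reflect (gproj V g v = v) (v \in gv_comp V g).
Proof. by apply: (iffP idP) => [/gproj_fix|<-]; last exact: gproj_mem. Qed.

Lemma homog_ext V (X : vectType K) (f f' : 'Hom(V, X)) :
  (forall g v, v \in gv_comp V g -> f v = f' v) -> f = f'.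
Proof.
move=> ff'; apply/lfunP => v; rewrite -[v]gproj_sum !linear_sum.
by apply: eq_bigr => g _; exact: ff' (gproj_mem g v).
Qed.

Lemma tens_gproj V W v w :
  tens v w = \sum_g \sum_h tens (gproj V g v) (gproj W h w).
Proof.
rewrite -{1}[v]gproj_sum tens_suml; apply: eq_bigr => g _.
by rewrite -{1}[w]gproj_sum tens_sumr.
Qed.

Lemma homog_tens_ext V W (X : vectType K) (f f' : 'Hom(tensor V W, X)) :
    (forall g h v w, v \in gv_comp V g -> w \in gv_comp W h ->
       f (tens v w) = f' (tens v w)) ->
  f = f'.
Proof.
move=> ff'; apply: tens_ext => v w; rewrite tens_gproj !linear_sum.
apply: eq_bigr => g _; rewrite !linear_sum; apply: eq_bigr => h _.
exact: ff' (gproj_mem g v) (gproj_mem h w).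
Qed.

Lemma homog_tens3_ext U V W (X : vectType K)
    (f f' : 'Hom(tensor (tensor U V) W, X)) :
    (forall g h k u v w,
       u \in gv_comp U g -> v \in gv_comp V h -> w \in gv_comp W k ->
       f (tens (tens u v) w) = f' (tens (tens u v) w)) ->
  f = f'.
Proof.
move=> ff'; apply: tens3_ext => u v w; rewrite (tens_gproj u v) tens_suml !linear_sum.
apply: eq_bigr => g _; rewrite tens_suml !linear_sum; apply: eq_bigr => h _.
rewrite -[w]gproj_sum tens_sumr !linear_sum; apply: eq_bigr => k _.
exact: ff' (gproj_mem g u) (gproj_mem h v) (gproj_mem k w).
Qed.

Lemma tens_homog V W g h v w :
  v \in gv_comp V g -> w \in gv_comp W h ->
  tens v w \in gv_comp (V ⊗ W) (g * h)%g.
Proof.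
move=> Vv Ww; rewrite /gtensor /=.
apply: (subvP (sumv_sup (g, h) _ (subvv _))) => //=; exact: mem_vtens.
Qed.

Lemma gproj_tens V W k v w :
  gproj (V ⊗ W) k (tens v w) =
  \sum_h tens (gproj V (k * h^-1)%g v) (gproj W h w).
Proof.
rewrite tens_gproj exchange_big linear_sum; apply: eq_bigr => h _ /=.
rewrite linear_sum (bigD1 (k * h^-1)%g) //= big1 ?addr0 => [|g gk].
  apply: (@gproj_fix (V ⊗ W) k); rewrite -[k in X in _ \in X](mulgVK h k).
  by apply: tens_homog; exact: gproj_mem.
rewrite (gproj_id _ (tens_homog (gproj_mem g v) (gproj_mem h w))).
by case: eqP => // kE; case/eqP: gk; rewrite kE mulgK.
Qed.

Lemma gmorP V W (f : 'Hom(V, W)) :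
  gmor f <-> forall g v, v \in gv_comp V g -> f v \in gv_comp W g.
Proof.
split=> [fg g v Vv|fg g]; first exact: subvP (fg g) _ (memv_img _ Vv).
by apply/subvP => _ /memv_imgP[v Vv ->]; exact: fg.
Qed.

Lemma gmor_gproj V W (f : 'Hom(V, W)) g v :
  gmor f -> f (gproj V g v) = gproj W g (f v).
Proof.
move=> /gmorP fg; rewrite -[v in RHS]gproj_sum !linear_sum (bigD1 g) //=.
rewrite big1 ?addr0 => [|h hg]; first by rewrite [RHS]gproj_fix ?fg ?gproj_mem.
by rewrite (gproj_id _ (fg h _ (gproj_mem h v))) eq_sym (negPf hg).
Qed.

Lemma gmorV V W (f : 'Hom(V, W)) :
  gmor f -> cancel f (f^-1)%VF -> cancel (f^-1)%VF f -> gmor (f^-1)%VF.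
Proof.
move=> fg fK fVK; apply/gmorP => g w Ww; apply/homogP.
by apply: (can_inj fK); rewrite (gmor_gproj _ _ fg) fVK gproj_fix.
Qed.

Lemma gmor_tens V W X (f : 'Hom(V ⊗ W, X)) :
    (forall g h v w, v \in gv_comp V g -> w \in gv_comp W h ->
       f (tens v w) \in gv_comp X (g * h)%g) ->
  gmor f.
Proof.
move=> fg; apply/gmorP => k t /gproj_fix <-.
rewrite [t]tensE !linear_sum; apply: memv_suml => i _.
rewrite !linear_sum; apply: memv_suml => j _.
rewrite !linearZ /=; apply: memvZ; rewrite (@gproj_tens V W k) linear_sum.
apply: memv_suml => h _; rewrite -[k in X in _ \in X](mulgVK h k).
by apply: fg; exact: gproj_mem.
Qed.

Lemma homog_onto_lfunK V W (X : vectType K) (f : 'Hom(X, V ⊗ W)) :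
    \dim {:X} = (\dim {:V} * \dim {:W})%N ->
    (forall g h v w, v \in gv_comp V g -> w \in gv_comp W h ->
       exists x, f x = tens v w) ->
  cancel f (f^-1)%VF /\ cancel (f^-1)%VF f.
Proof.
move=> dX onto; apply: onto_tens_lfunK => // v w.
suff /memv_imgP[x _ ->] : tens v w \in limg f by exists x.
rewrite tens_gproj; apply: memv_suml => g _; apply: memv_suml => h _.
have [x <-] := onto g h _ _ (gproj_mem g v) (gproj_mem h w).
by rewrite memv_img ?memvf.
Qed.

End Homogeneous.

Section Delta.
Variables (K : fieldType) (gT : finGroupType).

Lemma mem_delta (x : gT) (c : K^o) : c \in gv_comp (delta K x) x.
Proof. by rewrite /= eqxx memvf. Qed.

Lemma gproj_delta (x g : gT) (c : delta K x) :
  gproj (delta K x) g c = if g == x then c else 0.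
Proof. exact: gproj_id (mem_delta x c). Qed.

Lemma lunitE (V : vectType K) (c : K^o) (v : V) : lunit V (tens c v) = c *: v.
Proof.
by apply: tlift_tens => [w|d] k u v'; rewrite ?scalerDl ?scalerDr !scalerA // mulrC.
Qed.

Lemma lunit_invE (V : vectType K) (v : V) : lunit_inv V v = tens (1 : K^o) v.
Proof. exact: (linfunE (@tens_linear_r K K^o V 1)). Qed.

Lemma runitE (V : vectType K) (c : K^o) (v : V) : runit V (tens v c) = c *: v.
Proof.
by apply: tlift_tens => [w|d] k u v'; rewrite ?scalerDl ?scalerDr !scalerA // mulrC.
Qed.

Lemma runit_invE (V : vectType K) (v : V) : runit_inv V v = tens v (1 : K^o).
Proof. exact: (linfunE (@tens_linear_l K V K^o 1)). Qed.

Lemma runitK (V : vectType K) (t : tensor V K^o) : tens (runit V t) (1 : K^o) = t.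
Proof.
pose f := (runit_inv V \o runit V)%VF.
have -> : tens (runit V t) (1 : K^o) = f t by rewrite comp_lfunE runit_invE.
rewrite -[RHS]id_lfunE; congr (fun_of_lfun _ t); apply: tens_ext => v c.
rewrite comp_lfunE runitE runit_invE id_lfunE tensZl -tensZr.
by congr tens; exact: mulr1.
Qed.

End Delta.

(** * The associator on homogeneous elements *)

Section Associator.
Variables (K : fieldType) (gT : finGroupType) (nu : gT -> gT -> gT -> K).
Notation gvect := (gvect K gT).
Implicit Types U V W : gvect.

Lemma assoc_homog U V W g h k u v w :
    u \in gv_comp U g -> v \in gv_comp V h -> w \in gv_comp W k ->
  assoc nu U V W (tens (tens u v) w) = nu g h k *: tens u (tens v w).
Proof.
move=> Uu Vv Ww; rewrite sum_lfunE (bigD1 g) //= [X in _ + X]big1 => [|g' g'g].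
  rewrite addr0 sum_lfunE (bigD1 h) //= [X in _ + X]big1 => [|h' h'h].
    rewrite addr0 sum_lfunE (bigD1 k) //= [X in _ + X]big1 => [|k' k'k].
      rewrite addr0 scale_lfunE comp_lfunE !tmap_tens !gproj_fix //.
      by rewrite tassoc_tens.
    rewrite scale_lfunE comp_lfunE !tmap_tens (gproj_id k' Ww) (negPf k'k).
    by rewrite tens0r linear0 scaler0.
  rewrite sum_lfunE big1 // => k' _.
  rewrite scale_lfunE comp_lfunE !tmap_tens (gproj_id h' Vv) (negPf h'h).
  by rewrite tens0r tens0l linear0 scaler0.
rewrite sum_lfunE big1 // => h' _; rewrite sum_lfunE big1 // => k' _.
rewrite scale_lfunE comp_lfunE !tmap_tens (gproj_id g' Uu) (negPf g'g).
by rewrite !tens0l linear0 scaler0.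
Qed.

Hypothesis nu_neq0 : forall g h k, nu g h k != 0.

Lemma homog_onto3_lfunK U V W (X : vectType K)
   (f : 'Hom(X, tensor U (tensor V W))) :
    \dim {:X} = (\dim {:U} * (\dim {:V} * \dim {:W}))%N ->
    (forall g h k u v w,
       u \in gv_comp U g -> v \in gv_comp V h -> w \in gv_comp W k ->
       exists x, f x = tens u (tens v w)) ->
  cancel f (f^-1)%VF.
Proof.
move=> dX onto; apply: (onto_tens_lfunK _ _).1 => [|u t].
  by rewrite dX dim_tensor.
suff /memv_imgP[x _ ->] : tens u t \in limg f by exists x.
rewrite [t]tensE tens_sumr; apply: memv_suml => i _.
rewrite tens_sumr; apply: memv_suml => j _; rewrite tensZr; apply: memvZ.
rewrite -[u]gproj_sum tens_suml; apply: memv_suml => g _.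
rewrite tens_gproj tens_sumr; apply: memv_suml => h _.
rewrite tens_sumr; apply: memv_suml => k _.
have [x <-] := onto g h k _ _ _ (gproj_mem g u)
  (gproj_mem h (vbasis {:V})`_i) (gproj_mem k (vbasis {:W})`_j).
by rewrite memv_img ?memvf.
Qed.

Lemma assocK U V W : cancel (assoc nu U V W) (assoc nu U V W)^-1%VF.
Proof.
apply: homog_onto3_lfunK => [|g h k u v w Uu Vv Ww].
  by rewrite !dim_tensor mulnA.
exists ((nu g h k)^-1 *: tens (tens u v) w).
by rewrite linearZ /= (assoc_homog Uu Vv Ww) scalerA mulVf ?scale1r.
Qed.

Lemma assocV_homog U V W g h k u v w :
    u \in gv_comp U g -> v \in gv_comp V h -> w \in gv_comp W k ->
  (assoc nu U V W)^-1%VF (tens u (tens v w)) =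
    (nu g h k)^-1 *: tens (tens u v) w.
Proof.
move=> Uu Vv Ww; rewrite -[RHS]assocK linearZ /= (assoc_homog Uu Vv Ww).
by rewrite scalerA mulVf ?scale1r.
Qed.

End Associator.

(** * Restriction of operators to subspaces *)

Section Restriction.
Variables (K : fieldType) (V : vectType K) (S : {vspace V}).

Definition restr (f : 'End(V)) : 'End(subvs_of S) :=
  linfun (fun v => vsproj S (f (vsval v))).

Definition sub_incl : 'Hom(subvs_of S, V) := linfun vsval.

Lemma sub_inclE v : sub_incl v = vsval v.
Proof. exact: lfunE. Qed.

Lemma restrE (f : 'End(V)) (v : subvs_of S) : restr f v = vsproj S (f (vsval v)).
Proof. by apply: linfunE => k u u'; rewrite !linearP. Qed.

Lemma restr_val (f : 'End(V)) (v : subvs_of S) :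
  f (vsval v) \in S -> vsval (restr f v) = f (vsval v).
Proof. by rewrite restrE => /vsprojK. Qed.

Lemma tr_restr (f p : 'End(V)) :
    (forall v, p v \in S) -> {in S, forall v, p v = v} ->
    {in S, forall v, f v \in S} ->
  tr (restr f) = tr (f \o p)%VF.
Proof.
move=> pS p_id fS.
pose q : 'Hom(V, subvs_of S) := linfun (fun v => vsproj S (p v)).
have qE v : q v = vsproj S (p v).
  by apply: linfunE => k u u'; rewrite !linearP.
have -> : restr f = (q \o (f \o sub_incl))%VF.
  apply/lfunP => v; rewrite restrE !comp_lfunE qE sub_inclE p_id //.
  by rewrite fS // subvsP.
rewrite [LHS]trC; congr (tr _); apply/lfunP => v.
by rewrite !comp_lfunE qE sub_inclE vsprojK.
Qed.

End Restriction.

(** * Equivalence of projective representations *)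

Section ProjectiveEquivalence.
Variables (K : fieldType) (gT : finGroupType) (H : {set gT}).
Implicit Types U V W : vectType K.

Lemma fullv_neq0P V : {:V}%VS <> 0%VS <-> exists v : V, v != 0.
Proof.
split=> [V0|[v v0] E]; last by move: (memvf v) v0; rewrite E memv0 => ->.
exists (vpick {:V}); rewrite vpick0; exact/eqP.
Qed.

Lemma proj_equiv_refl V (rho : gT -> 'End(V)) : proj_equiv H rho rho.
Proof. by exists \1%VF, \1%VF; split=> *; rewrite !(comp_lfun1l, comp_lfun1r). Qed.

Lemma proj_equiv_sym V W (rho : gT -> 'End(V)) (psi : gT -> 'End(W)) :
  proj_equiv H rho psi -> proj_equiv H psi rho.
Proof.
move=> [f [f' [f'f ff' fM]]]; exists f', f; split=> // x Hx.
rewrite -[(f' \o psi x)%VF]comp_lfun1r -ff' comp_lfunA -[(_ \o f)%VF]comp_lfunA.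
by rewrite -fM // comp_lfunA f'f comp_lfun1l.
Qed.

Lemma proj_equiv_trans U V W (tau : gT -> 'End(U)) (rho : gT -> 'End(V))
    (psi : gT -> 'End(W)) :
  proj_equiv H tau rho -> proj_equiv H rho psi -> proj_equiv H tau psi.
Proof.
move=> [f [f' [f'f ff' fM]]] [g [g' [g'g gg' gM]]].
exists (g \o f)%VF, (f' \o g')%VF; split=> [||x Hx].
- by rewrite comp_lfunA -[(_ \o g)%VF]comp_lfunA g'g comp_lfun1r.
- by rewrite comp_lfunA -[(_ \o f')%VF]comp_lfunA ff' comp_lfun1r.
by rewrite -comp_lfunA fM // comp_lfunA gM // comp_lfunA.
Qed.

Lemma proj_equiv_irr V W (rho : gT -> 'End(V)) (psi : gT -> 'End(W)) :
  proj_equiv H rho psi -> proj_irr H rho -> proj_irr H psi.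
Proof.
move=> [f [f' [f'f ff' fM]]] [/fullv_neq0P[v v0] irr].
have fK v' : f' (f v') = v' by rewrite -comp_lfunE f'f id_lfunE.
have fVK u : f (f' u) = u by rewrite -comp_lfunE ff' id_lfunE.
split=> [|S stS].
  apply/fullv_neq0P; exists (f v); apply: contraNneq v0 => fv0.
  by rewrite -[v]fK fv0 linear0.
have st x : x \in H -> (rho x @: (f @^-1: S) <= f @^-1: S)%VS.
  move=> Hx; apply/subvP => _ /memv_imgP[v' + ->].
  rewrite -!memv_preim => Ufv; rewrite -comp_lfunE fM // comp_lfunE.
  exact: subvP (stS x Hx) _ (memv_img _ Ufv).
have [E|E] := irr _ st; [left|right]; apply/vspaceP => u.
  rewrite -{1}[u]fVK memv_preim E !memv0.
  apply/eqP/eqP => [u0|->]; last by rewrite linear0.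
  by rewrite -[u]fVK u0 linear0.
by rewrite -{1}[u]fVK memv_preim E !memvf.
Qed.

Lemma proj_equiv_character V W (rho : gT -> 'End(V)) (psi : gT -> 'End(W)) x :
  proj_equiv H rho psi -> x \in H -> character rho x = character psi x.
Proof.
move=> [f [f' [f'f ff' fM]]] Hx; rewrite /character.
have -> : rho x = (f' \o (psi x \o f))%VF.
  by rewrite -fM // comp_lfunA f'f comp_lfun1l.
by rewrite trC -comp_lfunA ff' comp_lfun1r.
Qed.

End ProjectiveEquivalence.

Section Center.
Variables (K : fieldType) (gT : finGroupType) (w : gT -> gT -> gT -> K).
Hypotheses (w_cocycle : cocycle3 w) (w_norm : normalized3 w).
Notation gvect := (gvect K gT).
Notation nu := (inv3 w).
Notation zobj := (zobj nu).

(** * The twisted 2-cocycles theta *)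

Lemma w_neq0 x y z : w x y z != 0. Proof. exact: w_cocycle.1. Qed.

Lemma inv3_neq0 x y z : nu x y z != 0.
Proof. by rewrite invr_eq0 w_neq0. Qed.

Lemma w1l x y : w 1%g x y = 1. Proof. by have [] := w_norm x y. Qed.
Lemma w1m x y : w x 1%g y = 1. Proof. by have [] := w_norm x y. Qed.
Lemma w1r x y : w x y 1%g = 1. Proof. by have [] := w_norm x y. Qed.

Lemma theta_neq0 g x y : theta w g x y != 0.
Proof. by rewrite !mulf_neq0 ?invr_eq0 ?w_neq0. Qed.

Lemma theta1l g y : theta w g 1%g y = 1.
Proof. by rewrite /theta w1l w1m invg1 mul1g mulg1 w1l !divr1 mulr1. Qed.

Lemma theta1r g x : theta w g x 1%g = 1.
Proof. by rewrite /theta !w1m !w1r mulr1 divr1. Qed.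

(** This is the 2-cocycle identity twisted by conjugation, and it is what makes
    the composition of three operators phi_x phi_y phi_z associative.  It is an
    alternating product of the four 3-cocycle identities at (g, x, y, z),
    (x, g1, y, z), (x, y, g2, z) and (x, y, z, g3), where g1, g2 and g3 are the
    conjugates of g that arise when g is moved to the right. *)
Lemma theta_cocycle g x y z :
  theta w g x y * theta w g (x * y)%g z =
  theta w g x (y * z)%g * theta w (x^-1 * g * x)%g y z.
Proof.
rewrite /theta.
set g1 := (x^-1 * g * x)%g.
have -> : ((x * y)^-1 * g * (x * y) = (x * y)^-1 * g * x * y)%g by rewrite !mulgA.
set g2 := ((x * y)^-1 * g * x * y)%g.
have -> : (y^-1 * g1 * y = g2)%g by rewrite /g1 /g2 invMg !mulgA.
have -> : ((y * z)^-1 * g1 * y * z = (x * y * z)^-1 * g * (x * y) * z)%g.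
  by rewrite /g1 !invMg !mulgA.
have -> : ((x * (y * z))^-1 * g * x * (y * z) =
    (x * y * z)^-1 * g * (x * y) * z)%g by rewrite !mulgA.
set g3 := ((x * y * z)^-1 * g * (x * y) * z)%g.
have gx : (g * x = x * g1)%g by rewrite /g1 !mulgA mulgV mul1g.
have gy : (g1 * y = y * g2)%g by rewrite /g1 /g2 invMg !mulgA mulgV mul1g.
have gz : (g2 * z = z * g3)%g.
  by rewrite /g2 /g3 !invMg !mulgA mulgV mul1g.
have [w0 wM] := w_cocycle.
have := wM g x y z; rewrite gx => e1.
have := wM x g1 y z; rewrite gy => e2.
have := wM x y g2 z; rewrite gz => e3.
have e4 := wM x y z g3.
have E1 : w g x y = w (x * g1)%g y z * w g x (y * z)%g / (w x y z * w g (x * y)%g z).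
  by apply: (canRL (mulfK _)); rewrite ?mulf_neq0 // -e1; ring.
have E2 : w x g1 y = w (x * g1)%g y z * w x g1 (y * z)%g / (w g1 y z * w x (y * g2)%g z).
  by apply: (canRL (mulfK _)); rewrite ?mulf_neq0 // -e2; ring.
have E3 : w x y g2 = w (x * y)%g g2 z * w x y (z * g3)%g / (w y g2 z * w x (y * g2)%g z).
  by apply: (canRL (mulfK _)); rewrite ?mulf_neq0 // -e3; ring.
have E4 : w (x * y)%g z g3 =
    w y z g3 * w x (y * z)%g g3 * w x y z / w x y (z * g3)%g.
  by apply: (canRL (mulfK _)); rewrite ?mulf_neq0 // e4.
rewrite E1 E2 E3 E4; field.
by rewrite !w0.
Qed.

Lemma theta_inv g x : (x * g = g * x)%g ->
  theta w g x x^-1%g = theta w g x^-1%g x.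
Proof.
move=> xg; have := theta_cocycle g x x^-1%g x.
by rewrite mulgV mulVg theta1l theta1r mulr1 mul1r -mulgA -xg mulKg.
Qed.

(** This makes phi_x intertwine phi_g on X_g with phi_h on X_h, where
    h = x g x^-1; hence the twist is a morphism of the center. *)
Lemma theta_selfconj g x h : (h * x = x * g)%g ->
  theta w h h x = theta w h x g.
Proof.
move=> hx; have xh : (x^-1 * h * x = g)%g by rewrite -mulgA hx mulKg.
have e1 : ((h * x)^-1 * h * h * x = g)%g.
  by rewrite invMg -!mulgA mulKg hx mulKg.
have e2 : ((x * g)^-1 * h * x * g = g)%g.
  by rewrite -(mulgA _ h x) hx mulVg mul1g.
rewrite /theta e1 e2 xh mulVg mul1g [LHS]mulrAC [RHS]mulfK ?w_neq0 //.
by rewrite divff ?mul1r ?w_neq0.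
Qed.

(** The scalar of the mate of a half braiding between X_g^* and Y_h, computed in
    [dual_hb_inv_homog]: three values of nu come from its associators and the
    last one from the evaluation of X.  Here k is the degree of X that phi_h
    moves to g. *)
Definition mate (g h : gT) : K :=
  let k := (h^-1 * g * h)%g in
  nu g^-1%g h k /
    (nu (g^-1 * h)%g k k^-1%g * nu g^-1%g g h * nu g g^-1%g g).

Lemma mate_neq0 g h : mate g h != 0.
Proof.
apply: mulf_neq0; first exact: inv3_neq0.
by apply: invr_neq0; do 2?apply: mulf_neq0; exact: inv3_neq0.
Qed.

(** On commuting degrees the scalar of the mate is the one by which phi_(g^-1)
    fails to invert phi_g on degree h, so it disappears from S.  The cocycle
    identity is used at (g^-1, h, g, g^-1), (g^-1, g, h, g^-1) and
    (g, g^-1, g, h g^-1). *)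
Lemma mate_comm g h : (g * h = h * g)%g -> mate g h = theta w h g g^-1%g.
Proof.
move=> gh; have hg : (h^-1 * g * h = g)%g by rewrite -mulgA gh mulKg.
rewrite /mate /theta /inv3 hg.
have -> : ((g * g^-1)^-1 * h * g * g^-1 = h)%g by rewrite mulgV invg1 mul1g mulgK.
have -> : (g^-1 * h * g = h)%g by rewrite -mulgA -gh mulKg.
have [w0 wM] := w_cocycle.
have := wM g^-1%g h g g^-1%g; rewrite mulgV w1r mulr1 -gh => e1.
have := wM g^-1%g g h g^-1%g; rewrite mulVg w1l mul1r => e2.
have := wM g g^-1%g g (h * g^-1)%g; rewrite mulgV mulVg w1l w1m mul1r mulr1.
have -> : (g * (h * g^-1) = h)%g by rewrite mulgA gh mulgK.
move=> e3; rewrite -e3 -e2 -e1; field.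
by rewrite !w0 oner_eq0.
Qed.

(** * Half braidings as twisted actions *)

(** The twisted actions that describe half braidings.  The base point of theta is
    the degree reached by f x (f y v). *)
Definition taction (V : gvect) (f : gT -> 'End(V)) : Prop :=
  [/\ f 1%g = \1%VF,
      forall x g v, v \in gv_comp V g -> f x v \in gv_comp V (x * g * x^-1)%g
    & forall x y g v, v \in gv_comp V g ->
        f x (f y v) = theta w (x * y * g * (x * y)^-1)%g x y *: f (x * y)%g v].

Lemma theta_target x y g :
  theta w (x * y * g * (x * y)^-1)%g x y =
  w (x * y * g * (x * y)^-1)%g x y * w x y g / w x (y * g * y^-1)%g y.
Proof.
rewrite /theta; congr (_ * w x y _ / w x _ y).
  by rewrite -[LHS]mulgA -[(x * y * g * _)%g]mulgA mulKg mulgVK.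
by rewrite invMg !mulgA mulgVK mulVg mul1g.
Qed.

Section FromAction.
Variables (V : gvect) (f : gT -> 'End(V)).
Hypothesis f_action : taction f.

Lemma tact1 v : f 1%g v = v.
Proof. by case: f_action => -> _ _; rewrite id_lfunE. Qed.

Lemma tact_mem x g v : v \in gv_comp V g -> f x v \in gv_comp V (x * g * x^-1)%g.
Proof. by case: f_action => _ + _; apply. Qed.

Lemma tactM x y g v : v \in gv_comp V g ->
  f x (f y v) = theta w (x * y * g * (x * y)^-1)%g x y *: f (x * y)%g v.
Proof. by case: f_action => _ _; apply. Qed.

Lemma tactK x g v : v \in gv_comp V g ->
  f x^-1%g (f x v) = theta w g x^-1%g x *: v.
Proof. by move/tactM->; rewrite mulVg mul1g invg1 mulg1 tact1. Qed.

Lemma tactVK x g v : v \in gv_comp V g ->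
  f x (f x^-1%g v) = theta w g x x^-1%g *: v.
Proof. by move=> Vv; rewrite -{1}[x]invgK (tactK _ Vv) invgK. Qed.

Lemma tact_gproj x g v :
  f x (gproj V g v) = gproj V (x * g * x^-1)%g (f x v).
Proof.
rewrite -[v in RHS]gproj_sum !linear_sum (bigD1 g) //= big1 ?addr0 => [|h hg].
  by rewrite [RHS]gproj_fix ?tact_mem ?gproj_mem.
rewrite (gproj_id _ (tact_mem x (gproj_mem h v))).
by rewrite !(inj_eq (mulIg _)) (inj_eq (mulgI x)) eq_sym (negPf hg).
Qed.

(** On y of degree x, the half braiding is y (x) v |-> phi_x v (x) y. *)
Definition act_hb (Y : gvect) : 'Hom(Y ⊗ V, V ⊗ Y) :=
  tlift (fun (y : Y) (v : V) => \sum_x tens (f x v) (gproj Y x y)).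

Lemma act_hbE (Y : gvect) y v :
  act_hb Y (tens y v) = \sum_x tens (f x v) (gproj Y x y).
Proof.
apply: tlift_tens => [u|t] k a b.
  rewrite scaler_sumr -big_split; apply: eq_bigr => x _ /=.
  by rewrite linearP tens_linear_r.
rewrite scaler_sumr -big_split; apply: eq_bigr => x _ /=.
by rewrite linearP tens_linear_l.
Qed.

Lemma act_hb_homog (Y : gvect) x y v : y \in gv_comp Y x ->
  act_hb Y (tens y v) = tens (f x v) y.
Proof.
move=> Yy; rewrite act_hbE (bigD1 x) //= big1 ?addr0 => [|x' x'x].
  by rewrite gproj_fix.
by rewrite (gproj_id _ Yy) (negPf x'x) tens0r.
Qed.

Fact act_hb_isom (Y : gvect) : gisom (act_hb Y).
Proof.
have [hK hVK] : cancel (act_hb Y) (act_hb Y)^-1%VF /\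
    cancel (act_hb Y)^-1%VF (act_hb Y).
  apply: homog_onto_lfunK => [|g x v y Vv Yy]; first by rewrite dim_tensor mulnC.
  exists ((theta w g x x^-1%g)^-1 *: tens y (f x^-1%g v)).
  rewrite linearZ /= (act_hb_homog _ Yy) (tactVK x Vv) tensZl scalerA.
  by rewrite mulVf ?scale1r ?theta_neq0.
have hg : gmor (act_hb Y).
  apply: gmor_tens => x g y v Yy Vv; rewrite (act_hb_homog _ Yy).
  rewrite -[(x * g)%g in X in _ \in X](mulgVK x (x * g)%g).
  exact: tens_homog (tact_mem _ Vv) Yy.
split=> //; exists (act_hb Y)^-1%VF; split.
- exact: gmorV.
- by apply/lfunP => t; rewrite comp_lfunE id_lfunE hK.
- by apply/lfunP => t; rewrite comp_lfunE id_lfunE hVK.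
Qed.

Fact act_hb_nat (Y Y' : gvect) (h : 'Hom(Y, Y')) : gmor h ->
  ((\1 ⊠ h) \o act_hb Y = act_hb Y' \o (h ⊠ \1))%VF.
Proof.
move=> /gmorP hg; apply: homog_tens_ext => x g y v Yy Vv.
rewrite !comp_lfunE tmap_tens (act_hb_homog _ Yy) tmap_tens !id_lfunE.
by rewrite (act_hb_homog _ (hg x y Yy)).
Qed.

(** The three associators of the hexagon reassemble, in the degrees at hand,
    to the inverse of the scalar in the twisted action. *)
Fact act_hb_tensor (Y Y' : gvect) :
  act_hb (Y ⊗ Y') =
    (assoc nu V Y Y' \o (act_hb Y ⊠ \1) \o (assoc nu Y V Y')^-1
        \o (\1 ⊠ act_hb Y') \o assoc nu Y Y' V)%VF.
Proof.
apply: homog_tens3_ext => x x' g y y' v Yy Yy' Vv.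
rewrite (act_hb_homog _ (tens_homog Yy Yy')) !comp_lfunE.
rewrite (assoc_homog _ Yy Yy' Vv) linearZ /= tmap_tens id_lfunE.
rewrite (act_hb_homog _ Yy') !linearZ /=.
rewrite (assocV_homog inv3_neq0 Yy (tact_mem x' Vv) Yy') !linearZ /=.
rewrite tmap_tens id_lfunE (act_hb_homog _ Yy) (tactM _ _ Vv) !tensZl !linearZ /=.
have := tact_mem (x * x')%g Vv => Vv'.
rewrite (assoc_homog _ Vv' Yy Yy') !scalerA theta_target /inv3.
rewrite -[LHS]scale1r; congr (_ *: _).
by field; rewrite !w_neq0 oner_eq0.
Qed.

Definition zobj_of_action : zobj :=
  ZObj act_hb_isom act_hb_nat act_hb_tensor.

Lemma phi_of_action x : phi zobj_of_action x = f x.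
Proof.
apply/lfunP => v; rewrite /phi !comp_lfunE lunit_invE /=.
by rewrite (act_hb_homog _ (mem_delta x 1)) runitE scale1r.
Qed.

End FromAction.

Section ToAction.
Variable X : zobj.

Lemma z_hb_delta x v : z_hb X (delta K x) (tens (1 : K^o) v) = tens (phi X x v) (1 : K^o).
Proof. by rewrite /phi !comp_lfunE lunit_invE runitK. Qed.

(** Naturality along the map delta x -> Y that picks y: the values on the
    one-dimensional objects determine the whole half braiding. *)
Lemma z_hb_homog (Y : gvect) x y v : y \in gv_comp Y x ->
  z_hb X Y (tens y v) = tens (phi X x v) y.
Proof.
move=> Yy; pose h : 'Hom(delta K x, Y) := linfun (fun c : K^o => c *: y).
have hE c : h c = c *: y.
  by rewrite linfunE // => k a b; rewrite scalerDl scalerA.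
have hg : gmor h.
  apply/gmorP => g c; rewrite /= hE; case: eqP => [-> _|_]; first exact: memvZ.
  by rewrite memv0 => /eqP->; rewrite scale0r mem0v.
have E := congr1 (fun F : 'Hom(_, _) => F (tens (1 : K^o) v)) (z_hb_nat X hg).
rewrite !comp_lfunE z_hb_delta !tmap_tens !id_lfunE (_ : h _ = y) in E.
  exact: esym E.
by rewrite hE scale1r.
Qed.

Lemma z_hb_inj (Y : gvect) : injective (z_hb X Y).
Proof.
have [_ [h [_ hK _]]] := z_hb_isom X Y.
by apply: (can_inj (g := h)) => t; rewrite -comp_lfunE hK id_lfunE.
Qed.

Lemma tens1_inj (V : vectType K) : injective (fun v : V => tens v (1 : K^o)).
Proof. by move=> u v /(congr1 (runit V)); rewrite !runitE !scale1r. Qed.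

(** The degrees and the scalar are read off the half braiding with delta x and
    the hexagon for delta x and delta y.  That phi_1 is the identity follows:
    it is injective, and idempotent because theta_g(1, 1) = 1. *)
Lemma phi_action : taction (phi X).
Proof.
have phi_mem x g v : v \in gv_comp X g -> phi X x v \in gv_comp X (x * g * x^-1)%g.
  move=> Xv; apply/homogP; apply: tens1_inj.
  have [/gmorP hg _] := z_hb_isom X (delta K x).
  have := hg _ _ (tens_homog (mem_delta x 1) Xv).
  rewrite z_hb_delta => /gproj_fix; rewrite gproj_tens (bigD1 x) //=.
  rewrite gproj_delta eqxx big1 ?addr0 // => h /negPf hx.
  by rewrite gproj_delta hx tens0r.
have phiM x y g v : v \in gv_comp X g ->
    phi X x (phi X y v) = theta w (x * y * g * (x * y)^-1)%g x y *: phi X (x * y)%g v.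
  move=> Xv.
  have xd := mem_delta x (1 : K^o); have yd := mem_delta y (1 : K^o).
  have := congr1 (fun F : 'Hom(_, _) => F (tens (tens (1 : K^o) (1 : K^o)) v))
    (z_hb_tensor X (delta K x) (delta K y)).
  rewrite (z_hb_homog _ (tens_homog xd yd)) !comp_lfunE.
  rewrite (assoc_homog _ xd yd Xv) linearZ /= tmap_tens id_lfunE.
  rewrite (z_hb_homog _ yd) !linearZ /=.
  rewrite (assocV_homog inv3_neq0 xd (phi_mem y _ _ Xv) yd) !linearZ /=.
  rewrite tmap_tens id_lfunE (z_hb_homog _ xd) !linearZ /=.
  have Xv' := phi_mem x _ _ (phi_mem y _ _ Xv).
  rewrite (assoc_homog _ Xv' xd yd) !scalerA.
  move=> /(congr1 (runit X \o (\1 ⊠ runit K^o))%VF).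
  rewrite !linearZ /= !comp_lfunE !tmap_tens !id_lfunE !runitE.
  rewrite !scale1r => ->; rewrite scalerA theta_target /inv3 -[LHS]scale1r.
  congr (_ *: _); rewrite !mulgA !invMg !mulgA.
  by field; rewrite !w_neq0 oner_eq0.
split=> //; apply: homog_ext => g v Xv; rewrite id_lfunE.
have phi1_inj : injective (phi X 1%g).
  move=> u u' /(congr1 (fun t => tens t (1 : K^o))); rewrite -!z_hb_delta.
  move=> E; have := congr1 (lunit X) (@z_hb_inj (delta K 1%g) _ _ E).
  by rewrite !lunitE !scale1r.
by apply: phi1_inj; rewrite (phiM 1%g 1%g g v Xv) theta1l scale1r mulg1.
Qed.

Lemma phi_mem x g v : v \in gv_comp X g -> phi X x v \in gv_comp X (x * g * x^-1)%g.
Proof. exact: tact_mem phi_action x g v. Qed.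

Lemma phiM x y g v : v \in gv_comp X g ->
  phi X x (phi X y v) = theta w (x * y * g * (x * y)^-1)%g x y *: phi X (x * y)%g v.
Proof. exact: tactM phi_action x y g v. Qed.

Lemma phi1 v : phi X 1%g v = v.
Proof. exact: tact1 phi_action v. Qed.

Lemma phiK x g v : v \in gv_comp X g ->
  phi X x^-1%g (phi X x v) = theta w g x^-1%g x *: v.
Proof. exact: tactK phi_action x g v. Qed.

Lemma phi_gproj x g v :
  phi X x (gproj X g v) = gproj X (x * g * x^-1)%g (phi X x v).
Proof. exact: tact_gproj phi_action x g v. Qed.

Lemma phi_inj x : injective (phi X x).
Proof.
move=> u u' E; rewrite -[u]gproj_sum -[u']gproj_sum; apply: eq_bigr => g _.
have Xu := gproj_mem g u; have Xu' := gproj_mem g u'.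
apply: (scalerI (theta_neq0 g x^-1%g x)).
by rewrite -(phiK _ Xu) -(phiK _ Xu') !phi_gproj E.
Qed.

End ToAction.

Lemma zmorP (X Y : zobj) (f : 'Hom(X, Y)) :
  zmor f <-> gmor f /\ forall x v, f (phi X x v) = phi Y x (f v).
Proof.
split=> [[fg fh]|[fg fphi]].
  split=> // x v.
  have := congr1 (fun F : 'Hom(_, _) => F (tens (1 : K^o) v)) (fh (delta K x)).
  rewrite 2!comp_lfunE z_hb_delta !tmap_tens !id_lfunE z_hb_delta.
  exact: tens1_inj.
split=> // Z; apply: homog_tens_ext => x g z v Zz Xv.
rewrite !comp_lfunE (z_hb_homog _ Zz) !tmap_tens !id_lfunE.
by rewrite (z_hb_homog _ Zz) fphi.
Qed.

(** * Subobjects, simplicity and Schur's lemma *)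

Definition stable (X : zobj) (S : {vspace X}) : Prop :=
  forall v, v \in S ->
    (forall g, gproj X g v \in S) /\ (forall x, phi X x v \in S).

Section Subobject.
Variables (X : zobj) (S : {vspace X}).
Hypothesis stS : stable S.

Let U g : {vspace subvs_of S} := (sub_incl S @^-1: gv_comp X g)%VS.
Let P g := restr S (gproj X g).

Let memU g v : (v \in U g) = (vsval v \in gv_comp X g).
Proof. by rewrite -memv_preim sub_inclE. Qed.

Let PE g v : vsval (P g v) = gproj X g (vsval v).
Proof. by apply: restr_val; have [] := stS (subvsP v). Qed.

Fact sub_proj g h v : v \in U h -> P g v = if g == h then v else 0.
Proof.
rewrite memU => Xv; apply: subvs_inj; rewrite PE (gproj_id _ Xv).
by case: eqP; rewrite ?linear0.
Qed.

Fact sub_total : (\sum_g U g)%VS = fullv.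
Proof.
apply: (@grading_total _ _ _ U P) => [g v|v]; first by rewrite memU PE gproj_mem.
apply: subvs_inj; rewrite linear_sum -[RHS](gproj_sum (vsval v)).
by apply: eq_bigr => g _; exact: PE.
Qed.

Definition sub_gvect : gvect := GVect (grading_direct sub_proj) sub_total.

Fact sub_action : taction (fun x => restr S (phi X x) : 'End(sub_gvect)).
Proof.
have fE x v : vsval (restr S (phi X x) v) = phi X x (vsval v).
  by apply: restr_val; have [_] := stS (subvsP v).
split=> [|x g v|x y g v].
- by apply/lfunP => v; apply: subvs_inj; rewrite fE id_lfunE phi1.
- by rewrite !memU fE; exact: phi_mem.
rewrite memU => Xv; apply: subvs_inj.
by rewrite linearZ /= !fE (phiM _ _ Xv).
Qed.

Definition sub_zobj : zobj := zobj_of_action sub_action.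

Lemma sub_incl_zmor : zmor (X := sub_zobj) (sub_incl S).
Proof.
apply/zmorP; split=> [|x v].
  by apply/gmorP => g v; rewrite memU sub_inclE.
rewrite (phi_of_action sub_action) !sub_inclE restr_val //.
by have [_] := stS (subvsP v).
Qed.

End Subobject.

Lemma zmor_zero (X Y : zobj) : zmor (0 : 'Hom(X, Y)).
Proof.
by apply/zmorP; split=> [|x v]; [apply/gmorP => g v _|];
  rewrite !zero_lfunE ?linear0 ?mem0v.
Qed.

Lemma lker_stable (X Y : zobj) (f : 'Hom(X, Y)) : zmor f -> stable (lker f).
Proof.
move=> /zmorP[fg fphi] v; rewrite memv_ker => /eqP fv.
by split=> [g|x]; rewrite memv_ker ?(gmor_gproj _ _ fg) ?fphi fv linear0.
Qed.

Lemma limg_stable (X Y : zobj) (f : 'Hom(X, Y)) : zmor f -> stable (limg f).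
Proof.
move=> /zmorP[fg fphi] _ /memv_imgP[v _ ->].
by split=> [g|x]; rewrite -?(gmor_gproj _ _ fg) -?fphi memv_img ?memvf.
Qed.

(** The inclusion of the kernel and the zero map have the same composite
    with f. *)
Lemma zmono_ker (X Y : zobj) (f : 'Hom(X, Y)) : zmor f -> zmono f -> lker f = 0%VS.
Proof.
move=> fm fmono; have st := lker_stable fm.
have E : sub_incl (lker f) = 0.
  apply: (fmono _ _ _ (sub_incl_zmor st) (zmor_zero _ _)); apply/lfunP => v.
  rewrite !comp_lfunE sub_inclE zero_lfunE linear0; apply/eqP.
  by rewrite -memv_ker subvsP.
apply/eqP; rewrite -subv0; apply/subvP => v kv; rewrite memv0.
by rewrite -(vsprojK kv) -sub_inclE E zero_lfunE.
Qed.

Lemma zmono_of_inj (X Y : zobj) (f : 'Hom(X, Y)) : injective f -> zmono f.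
Proof.
move=> finj Z g h _ _ E; apply/lfunP => v; apply: finj.
by rewrite -!comp_lfunE E.
Qed.

Lemma zisom_bij (X Y : zobj) (f : 'Hom(X, Y)) :
  zmor f -> lker f = 0%VS -> limg f = fullv -> zisom f.
Proof.
move=> fm /eqP f0 fT; have fK := lker0_lfunK f0.
have fVK : cancel (f^-1)%VF f by move=> v; rewrite limg_lfunVK // fT memvf.
split=> //; exists (f^-1)%VF; split.
- have /zmorP[fg fphi] := fm.
  apply/zmorP; split=> [|x v]; first exact: gmorV.
  by apply: (can_inj fK); rewrite fphi !fVK.
- exact: lker0_compVf.
- by apply/lfunP => v; rewrite comp_lfunE id_lfunE fVK.
Qed.

(** The inclusion of a stable subspace is a monomorphism; conversely the image
    of a monomorphism is stable, and its kernel vanishes. *)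
Lemma zsimpleP (X : zobj) :
  zsimple X <-> {:X}%VS != 0%VS /\
    forall S : {vspace X}, stable S -> S = 0%VS \/ S = fullv.
Proof.
have id0 : (\1%VF : 'End(X)) <> 0 <-> {:X}%VS != 0%VS.
  split=> [X0|/eqP X0 E].
    apply/eqP => E; apply: X0; apply/lfunP => v; apply/eqP.
    by rewrite id_lfunE zero_lfunE -memv0 -E memvf.
  apply: X0; apply/vspaceP => v; rewrite memvf memv0.
  by rewrite -[v]id_lfunE E zero_lfunE eqxx.
split=> [[/id0 X0 simX]|[/id0 X0 simX]]; split=> //.
  move=> S stS.
  have Sinj : injective (sub_incl S).
    by move=> u v; rewrite !sub_inclE; exact: subvs_inj.
  have [E|[_ [f [_ _ fK]]]] := simX (sub_zobj stS) (sub_incl S)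
    (sub_incl_zmor stS) (@zmono_of_inj (sub_zobj stS) X _ Sinj).
    left; apply/eqP; rewrite -subv0; apply/subvP => v Sv; rewrite memv0.
    by rewrite -(vsprojK Sv) -sub_inclE E zero_lfunE.
  right; apply/vspaceP => v; rewrite memvf -[v]id_lfunE -fK comp_lfunE.
  by rewrite sub_inclE subvsP.
move=> Y f fm fmono.
have [f0|fT] := simX _ (limg_stable fm).
  left; apply/lfunP => v; apply/eqP.
  by rewrite zero_lfunE -memv0 -f0 memv_img ?memvf.
by right; apply: zisom_bij => //; exact: zmono_ker.
Qed.

Lemma schur (X Y : zobj) (f : 'Hom(X, Y)) :
  zsimple X -> zsimple Y -> zmor f -> f <> 0 -> zisom f.
Proof.
move=> /zsimpleP[_ sX] /zsimpleP[_ sY] fm f0.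
have [k0|kT] := sX _ (lker_stable fm); last first.
  by case: f0; apply/lfunP => v; apply/eqP; rewrite zero_lfunE -memv_ker kT memvf.
have [i0|iT] := sY _ (limg_stable fm); last exact: zisom_bij.
case: f0; apply/lfunP => v; apply/eqP.
by rewrite zero_lfunE -memv0 -i0 memv_img ?memvf.
Qed.

(** * Simple objects and irreducible projective representations *)

Lemma cent1_conj (a x : gT) : x \in 'C[a]%g -> (x * a * x^-1)%g = a.
Proof. by move/cent1P => xa; rewrite xa mulgK. Qed.

Lemma mem_classP (a g : gT) :
  reflect (exists x, a = x * g * x^-1)%g (g \in a ^: [set: gT])%g.
Proof.
apply: (iffP imsetP) => [[x _ ->]|[x ->]].
  by exists x; rewrite conjgE !mulgA mulgV mul1g mulgK.
by exists x; rewrite ?inE // conjgE !mulgA mulVg mul1g mulgVK.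
Qed.

Lemma zrep_val (X : zobj) a x v : x \in 'C[a]%g ->
  vsval (zrep X a x v) = phi X x (vsval v).
Proof.
by move=> /cent1_conj xa; apply: restr_val; rewrite -{2}xa phi_mem ?subvsP.
Qed.

Lemma zrep1 (X : zobj) a : zrep X a 1%g = \1%VF.
Proof.
apply/lfunP => v; apply: subvs_inj.
by rewrite zrep_val ?group1 // phi1 id_lfunE.
Qed.

Lemma zrep_repr (X : zobj) a : proj_repr 'C[a]%g (theta w a) (zrep X a).
Proof.
have zM x y : x \in 'C[a]%g -> y \in 'C[a]%g ->
    (zrep X a x \o zrep X a y)%VF = theta w a x y *: zrep X a (x * y)%g.
  move=> Cx Cy; apply/lfunP => v; apply: subvs_inj.
  rewrite comp_lfunE scale_lfunE linearZ /= !zrep_val ?groupM //.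
  by rewrite (phiM x y (subvsP v)) cent1_conj ?groupM.
split=> [x Cx|x y]; last exact: zM.
have CV : x^-1%g \in 'C[a]%g by rewrite groupV.
exists ((theta w a x x^-1%g)^-1 *: zrep X a x^-1%g); split.
  rewrite -comp_lfunZl zM // mulVg zrep1 scalerA -theta_inv ?mulVf ?scale1r ?theta_neq0 //.
  exact/cent1P.
by rewrite -comp_lfunZr zM // mulgV zrep1 scalerA mulVf ?scale1r ?theta_neq0.
Qed.

Lemma homog_neq0 (X : zobj) (A : {set gT}) : zsupported X A ->
  {:X}%VS != 0%VS -> exists g v, [/\ g \in A, v \in gv_comp X g & v != 0].
Proof.
move=> suppX /eqP/fullv_neq0P[v v0].
have [/existsP[g gv]|/existsPn v_0] := boolP [exists g, gproj X g v != 0].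
  exists g, (gproj X g v); split=> //; last exact: gproj_mem.
  by apply: contraNT gv => /suppX E; rewrite -memv0 -E gproj_mem.
case/eqP: v0; rewrite -[v]gproj_sum big1 // => g _.
by apply/eqP; rewrite -[_ == _]negbK v_0.
Qed.

Lemma stable_class (X : zobj) (a : gT) :
  stable (\sum_(g in (a ^: [set: gT])%g) gv_comp X g)%VS.
Proof.
move=> _ /memv_sumP[u Xu ->].
split=> [g|x]; rewrite linear_sum; apply: memv_suml => h ah.
  rewrite /= (gproj_id _ (Xu h ah)); case: eqP => _; last exact: mem0v.
  exact: subvP (sumv_sup h ah (subvv _)) _ (Xu h ah).
have ah' : (x * h * x^-1)%g \in (a ^: [set: gT])%g.
  have [y ->] := mem_classP _ _ ah; apply/mem_classP.
  by exists (y * x^-1)%g; rewrite invMg invgK !mulgA !mulgVK.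
exact: subvP (sumv_sup _ ah' (subvv _)) _ (phi_mem x (Xu h ah)).
Qed.

(** The components over the conjugacy class of any degree that occurs span a
    nonzero subobject. *)
Lemma zsimple_supported (X : zobj) : zsimple X ->
  exists2 A, A \in classes [set: gT] & zsupported X A.
Proof.
move=> /zsimpleP[X0 simX].
have suppT : zsupported X [set: gT] by move=> g; rewrite inE.
have [a [v [_ Xv v0]]] := homog_neq0 suppT X0.
exists (a ^: [set: gT])%g; first by apply: mem_classes; rewrite inE.
have [E|E] := simX _ (@stable_class X a) => [|g ag].
  move: v0; rewrite -memv0 -E => /negP[].
  by apply: subvP (sumv_sup a _ (subvv _)) _ Xv; rewrite class_refl.
apply/eqP; rewrite -subv0; apply/subvP => u Xu.
have: u \in (\sum_(g in (a ^: [set: gT])%g) gv_comp X g)%VS by rewrite E memvf.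
move=> /memv_sumP[s Xs us]; rewrite memv0 -(gproj_fix Xu) us linear_sum.
rewrite big1 // => h ah; rewrite /= (gproj_id _ (Xs h ah)).
by case: eqP ag => // ->; rewrite ah.
Qed.

(** An object supported on the class of a is spanned by the translates of its
    component at a, so a stable subspace is determined by its intersection with
    that component, and any invariant subspace of it arises in this way. *)
Lemma zsimple_irr (X : zobj) a : zsupported X (a ^: [set: gT])%g ->
  zsimple X <-> proj_irr 'C[a]%g (zrep X a).
Proof.
move=> suppX; split.
  move=> /zsimpleP[X0 simX]; split=> [|U stU].
    have [g [v [/mem_classP[x ax] Xv v0]]] := homog_neq0 suppX X0.
    have Xa : phi X x v \in gv_comp X a by rewrite ax phi_mem.
    apply/fullv_neq0P; exists (Subvs Xa); apply: contraNneq v0.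
    move=> E; apply/eqP; apply: (@phi_inj X x).
    by rewrite -[LHS]/(vsval (Subvs Xa)) E !linear0.
  (* The translates of U form a stable subspace S that meets X_a in U. *)
  pose U' := (sub_incl (gv_comp X a) @: U)%VS.
  have U'a v : v \in U' -> v \in gv_comp X a.
    by move=> /memv_imgP[u _ ->]; rewrite sub_inclE subvsP.
  have stU' x v : x \in 'C[a]%g -> v \in U' -> phi X x v \in U'.
    move=> Cx /memv_imgP[u Uu ->]; rewrite sub_inclE -zrep_val // -sub_inclE.
    by apply: memv_img; apply: subvP (stU x Cx) _ (memv_img _ Uu).
  pose S := (\sum_x phi X x @: U')%VS.
  have memS x u : u \in U' -> phi X x u \in S.
    by move=> Uu; apply: subvP (sumv_sup x isT (subvv _)) _ (memv_img _ Uu).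
  have stS : stable S.
    move=> _ /memv_sumP[s Us ->].
    split=> [g|y]; rewrite linear_sum; apply: memv_suml => x _;
      have /memv_imgP[u Uu ->] := Us x isT.
      rewrite /= (gproj_id _ (phi_mem x (U'a u Uu))).
      by case: eqP => _; rewrite ?mem0v ?memS.
    by rewrite /= (phiM y x (U'a u Uu)); apply/memvZ/memS.
  have [E|E] := simX S stS; [left|right]; apply/vspaceP => v.
    rewrite memv0; apply/idP/eqP => [Uv|->]; last exact: mem0v.
    apply: subvs_inj; rewrite linear0; apply/eqP.
    by rewrite -memv0 -E -[vsval v]phi1 memS // -sub_inclE memv_img.
  rewrite memvf; have : vsval v \in S by rewrite E memvf.
  move=> /memv_sumP[s Us vs].
  suff /memv_imgP[u Uu /eqP] : vsval v \in U'.
    by rewrite sub_inclE (inj_eq (@subvs_inj _ _ _)) => /eqP->.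
  rewrite -(gproj_fix (subvsP v)) vs linear_sum; apply: memv_suml => x _.
  have /memv_imgP[u Uu ->] := Us x isT.
  rewrite /= (gproj_id _ (phi_mem x (U'a u Uu))).
  case: eqP => [ax|_]; last exact: mem0v.
  apply: stU' => //; apply/cent1P; rewrite /commute {2}ax.
  by rewrite mulgVK.
move=> [Xa0 irr]; apply/zsimpleP; split=> [|S stS].
  have /fullv_neq0P[v v0] := Xa0; apply/eqP/fullv_neq0P; exists (vsval v).
  by apply: contraNneq v0 => E; apply/eqP/subvs_inj; rewrite E linear0.
have st x : x \in 'C[a]%g -> (zrep X a x @: (sub_incl (gv_comp X a) @^-1: S) <=
    sub_incl (gv_comp X a) @^-1: S)%VS.
  move=> Cx; apply/subvP => _ /memv_imgP[v + ->].
  rewrite -!memv_preim !sub_inclE zrep_val // => Sv.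
  by have [_] := stS _ Sv.
have toa g v : g \in (a ^: [set: gT])%g -> v \in gv_comp X g ->
    exists x, phi X x v \in gv_comp X a.
  by move=> /mem_classP[x ax] Xv; exists x; rewrite ax phi_mem.
have [E|E] := irr _ st; [left|right]; apply/vspaceP => v.
  rewrite memv0; apply/idP/eqP => [Sv|->]; last exact: mem0v.
  rewrite -[v]gproj_sum big1 // => g _.
  have [ag|/suppX X0] := boolP (g \in (a ^: [set: gT])%g); last first.
    by apply/eqP; rewrite -memv0 -X0 gproj_mem.
  have [x Xa] := toa g _ ag (gproj_mem g v).
  apply: (@phi_inj X x); rewrite linear0.
  have: vsproj (gv_comp X a) (phi X x (gproj X g v)) == 0.
    rewrite -memv0 -E -memv_preim sub_inclE vsprojK //.
    by have [/(_ g) Sg _] := stS v Sv; have [_] := stS _ Sg.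
  by move=> /eqP/(congr1 vsval); rewrite vsprojK // linear0.
rewrite memvf -[v]gproj_sum; apply: memv_suml => g _.
have [ag|/suppX X0] := boolP (g \in (a ^: [set: gT])%g); last first.
  by have := gproj_mem g v; rewrite X0 memv0 => /eqP->; rewrite mem0v.
have [x Xa] := toa g _ ag (gproj_mem g v).
have : vsproj (gv_comp X a) (phi X x (gproj X g v)) \in fullv by rewrite memvf.
rewrite -E -memv_preim sub_inclE vsprojK // => /stS[_ /(_ x^-1%g)].
rewrite (phiK x (gproj_mem g v)) => /(memvZ (theta w g x^-1%g x)^-1).
by rewrite scalerA mulVf ?scale1r ?theta_neq0.
Qed.

(** * Induced objects *)

(** The induced object has a copy of V in each degree g of the class of a, to be
    thought of as the image of V under phi_(c g)^-1.  Normalizing c a = 1 makes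
    the copy at a carry rho itself. *)
Section Induced.
Variables (a : gT) (c : gT -> gT) (V : vectType K) (rho : gT -> 'End(V)).
Let A := (a ^: [set: gT])%g.
Hypotheses (c_conj : forall g, g \in A -> a = (c g * g * (c g)^-1)%g)
  (c_a : c a = 1%g) (rho_repr : proj_repr 'C[a]%g (theta w a) rho).

Let I := {g : gT | g \in A}.
Let E : vectType K := {ffun I -> V}.

(* Reading F at all of gT, with 0 outside of A, avoids membership proofs. *)
Let at_ (F : E) (g : gT) : V :=
  if insub g is Some i then (F : {ffun I -> V}) i else 0.

Let atE (F : {ffun I -> V}) (i : I) : at_ F (val i) = F i.
Proof. by rewrite /at_ valK. Qed.

Let at_out F g : g \notin A -> at_ F g = 0.
Proof. by move=> Ag; rewrite /at_ insubN. Qed.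

Let at_ext F F' : (forall g, g \in A -> at_ F g = at_ F' g) -> F = F'.
Proof. by move=> FF'; apply/ffunP => i; rewrite -!atE FF' // (valP i). Qed.

Let at_linear g : linear (at_^~ g).
Proof.
move=> k F F'; have [Ag|Ag] := boolP (g \in A); last first.
  by rewrite !at_out // scaler0 addr0.
by rewrite -[g]/(val (Sub g Ag : I)) !atE !ffunE.
Qed.

Let at0 g : at_ 0 g = 0.
Proof. by rewrite -(linfunE (at_linear g)) linear0. Qed.

Let atZ k F g : at_ (k *: F) g = k *: at_ F g.
Proof. by rewrite -!(linfunE (at_linear g)) linearZ. Qed.

Let mk (h : gT -> V) : E := [ffun i : I => h (val i)].

Let at_mk h g : g \in A -> at_ (mk h) g = h g.
Proof. by move=> Ag; rewrite -[g]/(val (Sub g Ag : I)) atE ffunE. Qed.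

Let P (g : gT) : 'End(E) :=
  linfun (fun F : E => mk (fun h => if h == g then at_ F h else 0)).

Let PE g F h : at_ (P g F) h = if h == g then at_ F h else 0.
Proof.
rewrite linfunE => [|k F1 F2].
  have [Ah|Ah] := boolP (h \in A); first by rewrite at_mk.
  by rewrite !at_out ?if_same.
apply: at_ext => h' Ah'; rewrite at_mk // !at_linear !at_mk //.
by case: eqP; rewrite // scaler0 addr0.
Qed.

Let U g : {vspace E} := limg (P g).

Let memU g F : reflect (forall h, h != g -> at_ F h = 0) (F \in U g).
Proof.
apply: (iffP idP) => [/memv_imgP[F' _ ->] h hg|F0].
  by rewrite PE (negPf hg).
apply/memv_imgP; exists F; rewrite ?memvf //; apply: at_ext => h _.
by rewrite PE; case: eqP => // /eqP/F0.
Qed.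

Fact ind_proj g h F : F \in U h -> P g F = if g == h then F else 0.
Proof.
move=> /memU F0; apply: at_ext => k _; rewrite PE.
case: (altP (k =P g)) => [->|kg]; last first.
  by case: (altP (g =P h)) => [gh|_]; rewrite ?at0 // F0 // -gh.
by case: (altP (g =P h)) => [//|gh]; rewrite F0 // at0.
Qed.

Fact ind_total : (\sum_g U g)%VS = fullv.
Proof.
apply: (@grading_total _ _ _ U P) => [g F|F]; first exact: memv_img (memvf _).
apply: at_ext => h _; rewrite -(linfunE (at_linear h)) linear_sum.
rewrite (bigD1 h) //= big1 ?addr0 => [|g gh].
  by rewrite (linfunE (at_linear h)) PE eqxx.
by rewrite (linfunE (at_linear h)) PE eq_sym (negPf gh).
Qed.

Definition ind_gvect : gvect := GVect (grading_direct ind_proj) ind_total.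

(* The element of the centralizer of a by which x moves the component at
   x^-1 g x to the component at g, once both are identified with V. *)
Let u g x : gT := (c g * x * (c (x^-1 * g * x)%g)^-1)%g.

(** The scalar comes from comparing phi_(c g) phi_x with phi_(u g x) phi_(c h),
    where h = x^-1 g x: both are multiples of phi_(c g x). *)
Definition ind_fun (x : gT) : 'End(E) := linfun (fun F : E => mk (fun g =>
  (theta w a (c g) x / theta w a (u g x) (c (x^-1 * g * x)%g)) *:
    rho (u g x) (at_ F (x^-1 * g * x)%g))).

Let Aconj g x : g \in A -> (x^-1 * g * x)%g \in A.
Proof.
move=> /mem_classP[y ay]; apply/mem_classP; exists (y * x)%g.
by rewrite [LHS]ay invMg !mulgA !mulgK.
Qed.

Let ind_funE x F g : g \in A -> at_ (ind_fun x F) g =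
  (theta w a (c g) x / theta w a (u g x) (c (x^-1 * g * x)%g)) *:
    rho (u g x) (at_ F (x^-1 * g * x)%g).
Proof.
move=> Ag; rewrite linfunE ?at_mk // => k F1 F2; apply: at_ext => h Ah.
rewrite at_mk // !at_linear !at_mk // linearP scalerDr !scalerA.
by rewrite [_ * k]mulrC.
Qed.

Let u_cent g x : g \in A -> u g x \in 'C[a]%g.
Proof.
move=> Ag; apply/cent1P; rewrite /commute /u.
rewrite {1}(c_conj (Aconj x Ag)) (c_conj Ag) !mulgA.
by rewrite !mulgVK mulgK.
Qed.

Let rho1 v : rho 1%g v = v.
Proof.
case: rho_repr => rhoV rhoM; have [r [rr _]] := rhoV 1%g (group1 _).
have := rhoM 1%g 1%g (group1 _) (group1 _).
rewrite theta1l scale1r mulg1 => E1.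
rewrite -[RHS]id_lfunE -rr comp_lfunE -[in RHS]E1 comp_lfunE -comp_lfunE.
by rewrite rr id_lfunE.
Qed.

Fact ind_action : taction (ind_fun : gT -> 'End(ind_gvect)).
Proof.
case: rho_repr => _ rhoM.
split=> [|x g F /memU F0|x y g F FU].
- apply/lfunP => F; apply: at_ext => g Ag; rewrite ind_funE // id_lfunE.
  rewrite /u invg1 !mul1g !mulg1 mulgV theta1r theta1l divr1 scale1r.
  exact: rho1.
- apply/memU => h hg; have [Ah|/at_out->//] := boolP (h \in A).
  rewrite ind_funE // F0 ?linear0 ?scaler0 //.
  by apply: contraNneq hg => <-; rewrite !mulgA mulgV mul1g mulgK.
have E1 h : h \in A -> at_ (ind_fun x (ind_fun y F)) h =
    theta w h x y *: at_ (ind_fun (x * y)%g F) h.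
  move=> Ah; have Ahx := Aconj x Ah.
  rewrite !ind_funE // linearZ /= scalerA -comp_lfunE rhoM ?u_cent //.
  have hxy : ((x * y)^-1 * h * (x * y) = y^-1 * (x^-1 * h * x) * y)%g.
    by rewrite invMg !mulgA.
  have uu : (u h x * u (x^-1 * h * x) y = u h (x * y))%g.
    by rewrite /u hxy !mulgA mulgVK.
  rewrite uu hxy scale_lfunE !scalerA; congr (_ *: _).
  set h1 := (x^-1 * h * x)%g; set h2 := (y^-1 * h1 * y)%g.
  have ux : (u h x * c h1 = c h * x)%g by rewrite /u mulgVK.
  have uy : (u h1 y * c h2 = c h1 * y)%g by rewrite /u mulgVK.
  have ch : ((c h)^-1 * a * c h = h)%g.
    by rewrite (c_conj Ah) !mulgA mulVg mul1g mulgVK.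
  have ca : ((u h x)^-1 * a * u h x = a)%g.
    by have /cent1P ua := u_cent x Ah; rewrite -mulgA -ua mulKg.
  (* The three ways to split c h x y = u h x . u h1 y . c h2 that matter. *)
  have := theta_cocycle a (c h) x y; rewrite ch => e1.
  have := theta_cocycle a (u h x) (c h1) y; rewrite ca ux => e2.
  have := theta_cocycle a (u h x) (u h1 y) (c h2); rewrite ca uy uu => e3.
  have th0 := theta_neq0.
  have {}e1 : theta w h x y = theta w a (c h) x * theta w a (c h * x)%g y /
      theta w a (c h) (x * y)%g.
    by apply: (canRL (mulfK (th0 _ _ _))); rewrite e1 mulrC.
  have {}e2 : theta w a (c h * x)%g y = theta w a (u h x) (c h1 * y)%g *
      theta w a (c h1) y / theta w a (u h x) (c h1).
    by apply: (canRL (mulfK (th0 _ _ _))); rewrite -e2 mulrC.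
  have {}e3 : theta w a (u h x) (u h1 y) = theta w a (u h x) (c h1 * y)%g *
      theta w a (u h1 y) (c h2) / theta w a (u h (x * y)%g) (c h2).
    by apply: (canRL (mulfK (th0 _ _ _))); rewrite -e3.
  by rewrite e1 e2 e3; field; rewrite !th0.
apply: at_ext => h Ah; rewrite E1 // atZ.
have [->//|hg] := eqVneq h (x * y * g * (x * y)^-1)%g.
move/memU: FU => F0; rewrite ind_funE // F0 ?linear0 ?scaler0 //.
by apply: contraNneq hg => <-; rewrite !mulgA mulgV mul1g -(mulgA h) mulgK.
Qed.

Definition ind_zobj : zobj := zobj_of_action ind_action.

Lemma ind_supported : zsupported ind_zobj A.
Proof.
move=> g Ag; apply/eqP; rewrite -subv0; apply/subvP => F /memU F0.
rewrite memv0; apply/eqP/at_ext => h Ah; rewrite F0 ?at0 //.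
by apply: contraNneq Ag => <-.
Qed.

Lemma ind_zrep : proj_equiv 'C[a]%g (zrep ind_zobj a) rho.
Proof.
have Aa : a \in A by exact: class_refl.
pose S := gv_comp ind_zobj a.
pose e : 'Hom(subvs_of S, V) := linfun (fun v : subvs_of S => at_ (vsval v) a).
have eE v : e v = at_ (vsval v) a.
  by apply: linfunE => k v1 v2; rewrite linearP at_linear.
pose single v := mk (fun g => if g == a then v else 0).
have S_single v : single v \in S.
  apply/memU => h ha; have [Ah|/at_out->//] := boolP (h \in A).
  by rewrite at_mk // (negPf ha).
pose e' : 'Hom(V, subvs_of S) := linfun (fun v => vsproj S (single v)).
have e'E v : e' v = vsproj S (single v).
  apply: linfunE => k v1 v2; rewrite -linearP; congr vsproj.
  apply: at_ext => h Ah; rewrite at_linear !at_mk //.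
  by case: eqP; rewrite // scaler0 addr0.
exists e, e'; split=> [||x Cx]; apply/lfunP => v; rewrite !comp_lfunE ?id_lfunE.
- apply: subvs_inj; rewrite eE e'E vsprojK //; apply: at_ext => h Ah.
  rewrite at_mk //; case: eqP => [->//|/eqP ha].
  by have /memU-> := subvsP v.
- by rewrite eE e'E vsprojK // at_mk // eqxx.
rewrite !eE zrep_val // phi_of_action ind_funE //.
have xa : (x^-1 * a * x)%g = a by have /cent1P xa := Cx; rewrite -mulgA -xa mulKg.
by rewrite /u xa c_a mul1g invg1 mulg1 theta1l theta1r divr1 scale1r.
Qed.

End Induced.

(** * The classification of simple objects *)

Lemma classes_class (A : {set gT}) a : A \in classes [set: gT] -> a \in A ->
  A = (a ^: [set: gT])%g.
Proof. by move=> /imsetP[x _ ->] /class_eqP. Qed.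

Lemma zisom_zrep (X Y : zobj) a (f : 'Hom(X, Y)) : zisom f ->
  proj_equiv 'C[a]%g (zrep X a) (zrep Y a).
Proof.
move=> [/zmorP[/gmorP fg fphi] [f' [/zmorP[/gmorP f'g _] f'f ff']]].
have fK v : f' (f v) = v by rewrite -comp_lfunE f'f id_lfunE.
have fVK v : f (f' v) = v by rewrite -comp_lfunE ff' id_lfunE.
pose e (U V : gvect) (h : 'Hom(U, V)) :
    'Hom(subvs_of (gv_comp U a), subvs_of (gv_comp V a)) :=
  linfun (fun v => vsproj (gv_comp V a) (h (vsval v))).
have eE (U V : gvect) (h : 'Hom(U, V)) v :
    e U V h v = vsproj (gv_comp V a) (h (vsval v)).
  by apply: linfunE => k v1 v2; rewrite !linearP.
exists (e X Y f), (e Y X f'); split=> [||x Cx]; apply/lfunP => v;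
  rewrite !comp_lfunE ?id_lfunE; apply: subvs_inj.
- by rewrite !eE !vsprojK ?f'g ?fg ?subvsP // fK.
- by rewrite !eE !vsprojK ?fg ?f'g ?subvsP // fVK.
rewrite (eE X Y f) zrep_val // vsprojK ?fphi; last first.
  by rewrite -fphi -zrep_val // fg ?subvsP.
by rewrite zrep_val // (eE X Y f) vsprojK ?fg ?subvsP.
Qed.

(** The sum of the translates phi_x^-1 f phi_x is a morphism of the center,
    since the scalars by which the actions on X and on Y fail to be
    multiplicative are the same and cancel.  On X_a only the x in C(a)
    contribute, each of them f. *)
Lemma zrep_zmor (X Y : zobj) a
    (f : 'Hom(subvs_of (gv_comp X a), subvs_of (gv_comp Y a))) :
    (forall x, x \in 'C[a]%g -> (f \o zrep X a x = zrep Y a x \o f)%VF) ->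
  exists F : 'Hom(X, Y), zmor F /\
    forall v, F (vsval v) = #|'C[a]%g|%:R *: vsval (f v).
Proof.
move=> fM.
pose T : 'Hom(X, Y) :=
  linfun (fun v => vsval (f (vsproj (gv_comp X a) (gproj X a v)))).
have TE v : T v = vsval (f (vsproj (gv_comp X a) (gproj X a v))).
  by apply: linfunE => k v1 v2; rewrite !linearP.
have phiVK x : cancel (phi Y x)^-1%VF (phi Y x).
  by apply: lker0_lfunVK; apply/lker0P; exact: phi_inj.
pose t x : 'Hom(X, Y) := ((phi Y x)^-1 \o T \o phi X x)%VF.
have tE x v : phi Y x (t x v) = T (phi X x v).
  by rewrite /t (comp_lfunE _ (phi X x)) (comp_lfunE _ T) phiVK.
have tg x g v : v \in gv_comp X g -> t x v \in gv_comp Y g.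
  move=> Xv; apply/homogP; apply: (@phi_inj Y x); rewrite phi_gproj tE TE.
  rewrite (gproj_id _ (phi_mem x Xv)); case: eqP => [<-|_].
    by rewrite gproj_fix ?subvsP.
  by rewrite !linear0.
exists (\sum_x t x); split.
  apply/zmorP; split=> [|y].
    apply/gmorP => g v Xv; rewrite sum_lfunE; apply: memv_suml => x _.
    exact: tg.
  suff E : ((\sum_x t x) \o phi X y = phi Y y \o (\sum_x t x))%VF.
    by move=> v; rewrite -!comp_lfunE E.
  apply: homog_ext => g v Xv; rewrite (comp_lfunE _ (phi X y)).
  rewrite (comp_lfunE (phi Y y)) !sum_lfunE linear_sum.
  rewrite [RHS](reindex_inj (mulIg y)) /=; apply: eq_bigr => x _.
  apply: (@phi_inj Y x); rewrite tE (phiM x y Xv) linearZ /=.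
  by rewrite (phiM x y (tg _ _ _ Xv)) tE.
move=> v; rewrite sum_lfunE (bigID (mem 'C[a]%g)) /= [X in _ + X]big1 ?addr0.
  rewrite scaler_nat -sumr_const; apply: eq_bigr => x Cx.
  apply: (@phi_inj Y x); rewrite tE TE gproj_fix; last first.
    by rewrite -{2}(cent1_conj Cx) phi_mem ?subvsP.
  by rewrite -!zrep_val // vsvalK -comp_lfunE fM // comp_lfunE zrep_val.
move=> x Cx; apply: (@phi_inj Y x); rewrite tE TE.
rewrite (gproj_id _ (phi_mem x (subvsP v))); case: eqP => [ax|_].
  by case/cent1P: Cx; rewrite /commute {2}ax mulgVK.
by rewrite !linear0.
Qed.

Lemma ziso_zrep (X Y : zobj) a : zsimple X -> zsimple Y ->
    zsupported X (a ^: [set: gT])%g -> #|'C[a]%g|%:R != 0 :> K ->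
  ziso X Y <-> proj_equiv 'C[a]%g (zrep X a) (zrep Y a).
Proof.
move=> sX sY suppX C0; split=> [[f]|]; first exact: zisom_zrep.
move=> [f [f' [f'f _ fM]]]; have [F [Fm FE]] := zrep_zmor fM.
exists F; apply: schur => // F0.
have [/fullv_neq0P[v v0] _] := (zsimple_irr suppX).1 sX.
case/eqP: v0; rewrite -[v]id_lfunE -f'f comp_lfunE.
suff -> : f v = 0 by rewrite linear0.
apply: subvs_inj; apply: (scalerI C0).
by rewrite -FE F0 zero_lfunE !linear0.
Qed.

Section Classification.
Variable a : {set gT} -> gT.
Hypothesis a_rep : forall A, A \in classes [set: gT] -> a A \in A.

Let aE A : A \in classes [set: gT] -> A = (a A ^: [set: gT])%g.
Proof. by move=> cA; apply: classes_class (a_rep cA). Qed.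

Lemma zsimple_triple (X : zobj) : zsimple X ->
  exists t, is_triple a w t /\ attached a X t.
Proof.
move=> sX; have [A cA suppX] := zsimple_supported sX.
exists (Triple A (zrep X (a A))); split; split=> //=; last exact: proj_equiv_refl.
  exact: zrep_repr.
by apply/zsimple_irr => //; rewrite -aE.
Qed.

Lemma triple_zsimple (t : triple K gT) : is_triple a w t ->
  exists X : zobj, zsimple X /\ attached a X t.
Proof.
case: t => A V rho [/= cA rho_repr rho_irr].
pose c g : gT :=
  if g == a A then 1%g else odflt 1%g [pick x | a A == (x * g * x^-1)%g].
have c_conj g : g \in (a A ^: [set: gT])%g -> a A = (c g * g * (c g)^-1)%g.
  rewrite /c; case: eqP => [->|_ /mem_classP[x ax]]; first by rewrite mul1g invg1 mulg1.
  by case: pickP => [y /eqP//|/(_ x)/eqP].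
have c_a : c (a A) = 1%g by rewrite /c eqxx.
pose X := ind_zobj c_conj rho_repr.
have suppX : zsupported X (a A ^: [set: gT])%g by exact: ind_supported.
have Xrho : proj_equiv 'C[a A]%g (zrep X (a A)) rho by exact: ind_zrep.
exists X; split; last by split=> //=; rewrite (aE cA).
by apply/(zsimple_irr suppX)/(proj_equiv_irr (proj_equiv_sym Xrho)).
Qed.

Lemma attached_ziso (X Y : zobj) (s t : triple K gT) :
    (forall x : gT, #|'C[x]%g|%:R != 0 :> K) ->
    zsimple X -> zsimple Y -> is_triple a w s -> is_triple a w t ->
    attached a X s -> attached a Y t ->
  ziso X Y <-> triple_equiv a s t.
Proof.
case: s t => [A V rho] [B W psi] C0 sX sY [/= cA _ _] [/= cB _ _].
move=> [/= suppX Xrho] [/= suppY Ypsi].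
have suppXa : zsupported X (a A ^: [set: gT])%g by rewrite -aE.
split=> [XY|[/= AB rhopsi]].
  have EAB : A = B.
    have [f [/zmorP[/gmorP fg _] [f' [_ f'f _]]]] := XY.
    have /zsimpleP[X0 _] := sX.
    have [g [v [Ag Xv v0]]] := homog_neq0 suppX X0.
    have Bg : g \in B.
      apply: contraNT v0 => /suppY Y0; rewrite -[v]id_lfunE -f'f comp_lfunE.
      by have := fg _ _ Xv; rewrite Y0 memv0 => /eqP->; rewrite linear0.
    by rewrite (classes_class cA Ag) (classes_class cB Bg).
  split=> //=; subst B.
  apply: proj_equiv_trans (proj_equiv_sym Xrho) _.
  by apply: proj_equiv_trans _ Ypsi; apply/(ziso_zrep sX sY suppXa).
subst B; apply/(ziso_zrep sX sY suppXa (C0 _)).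
apply: proj_equiv_trans Xrho _.
exact: proj_equiv_trans rhopsi (proj_equiv_sym Ypsi).
Qed.

End Classification.

(** * Evaluation, coevaluation and the twist *)

Lemma evE (V : gvect) l v :
  ev nu V (tens l v) = \sum_g (nu g g^-1%g g)^-1 *: (l : 'Hom(V, K^o)) (gproj V g v).
Proof.
apply: tlift_tens => [u|m] k a b; rewrite scaler_sumr -big_split;
  apply: eq_bigr => g _ /=.
  by rewrite add_lfunE scale_lfunE scalerDr !scalerA mulrC.
by rewrite !linearP.
Qed.

Lemma dual_homog (V : gvect) k (l : 'Hom(V, K^o)) :
  (l \o gproj V k)%VF \in gv_comp (gdual V) k^-1%g.
Proof.
apply/mem_gdual => h v; rewrite invgK => hk Vv.
by rewrite comp_lfunE (gproj_id _ Vv) eq_sym (negPf hk) linear0.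
Qed.

Lemma gproj_gdual (V : gvect) g (l : gdual V) :
  gproj (gdual V) g l = ((l : 'Hom(V, K^o)) \o gproj V g^-1%g)%VF.
Proof.
have lD h : ((l : 'Hom(V, K^o)) \o gproj V h^-1%g)%VF \in gv_comp (gdual V) h.
  by rewrite -[h in X in _ \in X]invgK; exact: dual_homog.
have {1}-> : l = \sum_h ((l : 'Hom(V, K^o)) \o gproj V h^-1%g)%VF :> gdual V.
  apply/lfunP => v; rewrite sum_lfunE -{1}[v]gproj_sum linear_sum.
  rewrite (reindex_inj invg_inj); apply: eq_bigr => h _.
  by rewrite comp_lfunE.
rewrite linear_sum (bigD1 g) //= big1 ?addr0 => [|h hg].
  by rewrite (gproj_fix (lD g)).
by rewrite (gproj_id _ (lD h)) eq_sym (negPf hg).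
Qed.

Lemma pivE (V : gvect) v l : (piv nu V v : 'Hom(gdual V, K^o)) l =
  \sum_g nu g^-1%g g g^-1%g *: (l : 'Hom(V, K^o)) (gproj V g v).
Proof.
pose p (v : V) : 'Hom(gdual V, K^o) := linfun (fun phi : 'Hom(V, K^o) =>
  \sum_g nu g^-1%g g g^-1%g *: phi (gproj V g v)).
have pE v' l' : p v' l' =
    \sum_g nu g^-1%g g g^-1%g *: (l' : 'Hom(V, K^o)) (gproj V g v').
  apply: linfunE => k a b; rewrite scaler_sumr -big_split.
  apply: eq_bigr => g _ /=.
  by rewrite add_lfunE scale_lfunE scalerDr !scalerA mulrC.
rewrite -pE; congr (fun_of_lfun _ l).
apply: (@linfunE _ V ('Hom(gdual V, K^o)) p) => k a b; apply/lfunP => l'.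
rewrite add_lfunE scale_lfunE !pE scaler_sumr -big_split.
by apply: eq_bigr => g _ /=; rewrite !linearP.
Qed.

(** The scalar nu(g^-1, g, g^-1) of the pivotal structure on V_g cancels the one
    of the evaluation of V^* in degree g^-1. *)
Lemma ev'E (V : gvect) v (l : gdual V) : ev' nu V (tens v l) = (l : 'Hom(V, K^o)) v.
Proof.
rewrite /ev' comp_lfunE tmap_tens id_lfunE evE.
rewrite -[v in RHS]gproj_sum linear_sum (reindex_inj invg_inj) /=.
apply: eq_bigr => g _; rewrite pivE (bigD1 g) //= big1 ?addr0 => [|h hg].
  rewrite gproj_gdual comp_lfunE invgK gproj_fix ?gproj_mem //.
  by rewrite scalerA mulVf ?scale1r ?inv3_neq0.
rewrite gproj_gdual comp_lfunE invgK (gproj_id _ (gproj_mem h v)).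
by rewrite eq_sym (negPf hg) linear0 scaler0.
Qed.

Lemma coev1 (V : gvect) : coev V (1 : K^o) =
  \sum_(i < \dim {:V}) tens (vbasis {:V})`_i (dual_basis V i : gdual V).
Proof.
rewrite /coev linfunE ?scale1r // => k c d.
by rewrite scalerDl scalerA.
Qed.

(** The canonical element of V (x) V^* is the sum of those of the homogeneous
    components, so it may be fed to maps known on homogeneous vectors. *)
Lemma coev1_homog (V : gvect) : coev V (1 : K^o) =
  \sum_k \sum_(i < \dim {:V}) tens (gproj V k (vbasis {:V})`_i)
    ((dual_basis V i \o gproj V k)%VF : gdual V).
Proof.
rewrite coev1; under eq_bigr => i _ do
  rewrite -{1}[(vbasis {:V})`_i]gproj_sum tens_suml.
rewrite exchange_big; apply: eq_bigr => k _ /=.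
have := congr1 (tmap (gproj V k) \1%VF) (frame_dual_map (gproj V k)).
rewrite !linear_sum /=.
under eq_bigr do rewrite tmap_tens id_lfunE gproj_fix ?gproj_mem //.
move=> ->; apply: eq_bigr => i _.
by rewrite tmap_tens id_lfunE.
Qed.

Lemma dual_basis_sum (V W : vectType K) (f : 'Hom(V, W)) v :
  \sum_(i < \dim {:V}) dual_basis V i v *: f (vbasis {:V})`_i = f v.
Proof.
rewrite [v in RHS](coord_basis (vbasisP {:V})) ?memvf // linear_sum.
by apply: eq_bigr => i _; rewrite linearZ dual_basisE.
Qed.

(** The partial trace pairs v with the dual vector of degree g^-1, which selects
    the component X_g; there both associators have the degrees (g, g, g^-1) and
    cancel. *)
Lemma twist_homog (X : zobj) g v : v \in gv_comp X g -> twist X v = phi X g v.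
Proof.
move=> Xv.
pose Q := (runit X \o (\1 ⊠ ev' nu X) \o assoc nu X X (gdual X)
   \o (braiding X X ⊠ \1) \o (assoc nu X X (gdual X))^-1)%VF.
have QE k x (l : gdual X) : x \in gv_comp X k -> l \in gv_comp (gdual X) k^-1%g ->
    Q (tens v (tens x l)) = (l : 'Hom(X, K^o)) v *: phi X g x.
  move=> Xx Dl; rewrite /Q.
  rewrite (comp_lfunE _ (assoc nu X X (gdual X))^-1%VF).
  rewrite (comp_lfunE _ (braiding X X ⊠ \1)).
  rewrite (comp_lfunE _ (assoc nu X X (gdual X))).
  rewrite (comp_lfunE _ (\1 ⊠ ev' nu X)).
  rewrite (assocV_homog inv3_neq0 Xv Xx Dl) !linearZ /=.
  rewrite (tmap_tens (braiding X X)) id_lfunE /braiding (z_hb_homog x Xv).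
  rewrite (assoc_homog nu (phi_mem g Xx) Xv Dl) !linearZ /=.
  rewrite tmap_tens id_lfunE ev'E runitE !scalerA.
  have [->|gk] := eqVneq k g.
    by rewrite mulgK mulfV ?mul1r ?inv3_neq0.
  have /mem_gdual/(_ g v) -> := Dl; rewrite ?mulr0 ?scale0r //.
  by rewrite invgK eq_sym.
pose L : 'Hom(X ⊗ gdual X, X) :=
  (Q \o linfun (fun t : X ⊗ gdual X => tens v t))%VF.
have LE t : L t = Q (tens v t).
  by rewrite comp_lfunE (linfunE (@tens_linear_r K X (X ⊗ gdual X) v)).
have -> : twist X v = L (coev X (1 : K^o)).
  rewrite LE /twist -/Q (comp_lfunE _ (runit_inv X)) (comp_lfunE Q).
  by rewrite runit_invE tmap_tens id_lfunE.
rewrite coev1_homog linear_sum (bigD1 g) //= [X in _ + X]big1 ?addr0 => [|k kg].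
  rewrite linear_sum; have := dual_basis_sum (phi X g \o gproj X g)%VF v.
  rewrite (comp_lfunE (phi X g)) (gproj_fix Xv) => <-; apply: eq_bigr => i _.
  rewrite /= LE (QE g) ?gproj_mem ?dual_homog // (comp_lfunE (dual_basis X i)).
  by rewrite (comp_lfunE (phi X g)) (gproj_fix Xv).
rewrite linear_sum big1 // => i _ /=; rewrite LE.
rewrite (QE k) ?gproj_mem ?dual_homog // comp_lfunE (gproj_id _ Xv).
by rewrite (negPf kg) linear0 scale0r.
Qed.

Lemma twist_zmor (X : zobj) : zmor (X := X) (Y := X) (twist X).
Proof.
apply/zmorP; split=> [|x].
  apply/gmorP => g v Xv; rewrite (twist_homog Xv) -{2}(mulgK g g).
  exact: phi_mem.
suff E : (twist X \o phi X x = phi X x \o twist X)%VF.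
  by move=> v; rewrite -(comp_lfunE (twist X)) E (comp_lfunE (phi X x)).
apply: homog_ext => g v Xv.
rewrite (comp_lfunE (twist X)) (comp_lfunE (phi X x)).
rewrite (twist_homog Xv) (twist_homog (phi_mem x Xv)) !(phiM _ _ Xv).
set h := (x * g * x^-1)%g.
have hx : (h * x = x * g)%g by rewrite /h mulgVK.
have -> : (h * x * g * (h * x)^-1 = h)%g.
  by rewrite hx invMg !mulgA mulgK.
have -> : (x * g * g * (x * g)^-1 = h)%g.
  by rewrite invMg !mulgA mulgK.
by rewrite (theta_selfconj hx) hx.
Qed.

(** * The double braiding with a dual object *)

(** The canonical spherical structure gives the plain trace. *)
Lemma cattr_tr (V : gvect) (f : 'End(V)) : cattr nu f = tr f.
Proof.
rewrite /cattr (comp_lfunE _ (coev V)) (comp_lfunE (ev' nu V)).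
rewrite coev1 !linear_sum trE; apply: eq_bigr => i _ /=.
by rewrite tmap_tens id_lfunE ev'E dual_basisE.
Qed.

(** In the mate, the canonical element of X (x) X^* contributes only through its
    component X_k with k = h^-1 g h, since phi_h has to land in the degree g on
    which l does not vanish. *)
Lemma dual_hb_inv_homog (X : zobj) (Y : gvect) g h (l : gdual X) y :
    l \in gv_comp (gdual X) g^-1%g -> y \in gv_comp Y h ->
  dual_hb_inv X Y (tens l y) =
    mate g h *: tens y (((l : 'Hom(X, K^o)) \o phi X h)%VF : gdual X).
Proof.
move=> Dl Yy.
have l0 t x : x \in gv_comp X t -> t != g -> (l : 'Hom(X, K^o)) x = 0.
  by move=> Xx tg; have /mem_gdual/(_ t x) -> := Dl; rewrite ?invgK.
pose Q := ((lunit Y ⊠ \1)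
   \o ((ev nu X ⊠ \1) ⊠ \1)
   \o ((assoc nu (gdual X) X Y)^-1 ⊠ \1)
   \o ((\1 ⊠ z_hb X Y) ⊠ \1)
   \o (assoc nu (gdual X) Y X ⊠ \1)
   \o (assoc nu (gdual X ⊗ Y) X (gdual X))^-1)%VF.
have QE k x (m : gdual X) : x \in gv_comp X k -> m \in gv_comp (gdual X) k^-1%g ->
    Q (tens (tens l y) (tens x m)) =
    (mate g h * (l : 'Hom(X, K^o)) (phi X h x)) *: tens y m.
  move=> Xx Dm; rewrite /Q.
  rewrite (comp_lfunE _ (assoc nu (gdual X ⊗ Y) X (gdual X))^-1%VF).
  rewrite (comp_lfunE _ (assoc nu (gdual X) Y X ⊠ \1)).
  rewrite (comp_lfunE _ ((\1 ⊠ z_hb X Y) ⊠ \1)).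
  rewrite (comp_lfunE _ ((assoc nu (gdual X) X Y)^-1 ⊠ \1)).
  rewrite (comp_lfunE _ ((ev nu X ⊠ \1) ⊠ \1)).
  rewrite (assocV_homog inv3_neq0 (tens_homog Dl Yy) Xx Dm) !linearZ /=.
  rewrite tmap_tens id_lfunE (assoc_homog nu Dl Yy Xx) tensZl !linearZ /=.
  rewrite (tmap_tens (\1 ⊠ z_hb X Y)) (tmap_tens \1 (z_hb X Y)) !id_lfunE.
  rewrite (z_hb_homog x Yy).
  have Xhx := phi_mem h Xx.
  rewrite (tmap_tens (assoc nu (gdual X) X Y)^-1%VF) id_lfunE.
  rewrite (assocV_homog inv3_neq0 Dl Xhx Yy) tensZl !linearZ /=.
  rewrite (tmap_tens (ev nu X ⊠ \1)) (tmap_tens (ev nu X)) !id_lfunE.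
  rewrite (tmap_tens (lunit Y)) id_lfunE lunitE tensZl.
  rewrite !scalerA; congr (_ *: _); rewrite evE.
  have [kE|hkg] := eqVneq (h * k * h^-1)%g g; last first.
    rewrite (l0 _ _ Xhx) // mulr0 big1 ?mulr0 // => j _.
    have [->|jg] := eqVneq j g; last first.
      by rewrite (l0 _ _ (gproj_mem j _)) // scaler0.
    by rewrite (gproj_id _ Xhx) eq_sym (negPf hkg) linear0 scaler0.
  rewrite (bigD1 g) //= big1 ?addr0 => [|j jg]; last first.
    by rewrite (l0 _ _ (gproj_mem j _)) // scaler0.
  have Xg : phi X h x \in gv_comp X g by rewrite -kE.
  rewrite (gproj_fix Xg) kE.
  have <- : (h^-1 * g * h = k)%g by rewrite -kE !mulgA mulVg mul1g mulgVK.
  rewrite mulrA; congr (_ * _); rewrite /mate.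
  by field; rewrite !inv3_neq0.
pose L : 'Hom(X ⊗ gdual X, Y ⊗ gdual X) :=
  (Q \o linfun (fun t : X ⊗ gdual X => tens (tens l y : gdual X ⊗ Y) t))%VF.
have LE t : L t = Q (tens (tens l y : gdual X ⊗ Y) t).
  by rewrite comp_lfunE (linfunE (@tens_linear_r K (gdual X ⊗ Y) (X ⊗ gdual X) _)).
(* R agrees with L on the homogeneous terms of the canonical element and is
   given by one formula on all tensors, so it may be evaluated in any basis. *)
pose R : 'Hom(X ⊗ gdual X, Y ⊗ gdual X) := tlift (fun (x : X) (m : gdual X) =>
  (mate g h * (l : 'Hom(X, K^o)) (phi X h x)) *: tens y m).
have RE x m : R (tens x m) =
    (mate g h * (l : 'Hom(X, K^o)) (phi X h x)) *: tens y m.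
  apply: tlift_tens => [m'|x'] k b d.
    have -> : (l : 'Hom(X, K^o)) (phi X h (k *: b + d)) =
        k * (l : 'Hom(X, K^o)) (phi X h b) + (l : 'Hom(X, K^o)) (phi X h d).
      by rewrite !linearP.
    by rewrite mulrDr scalerDl scalerA mulrCA.
  by rewrite tens_linear_r scalerDr !scalerA mulrC.
have -> : dual_hb_inv X Y (tens l y) = L (coev X (1 : K^o)).
  rewrite LE /dual_hb_inv -/Q (comp_lfunE _ (runit_inv (gdual X ⊗ Y))) (comp_lfunE Q).
  by rewrite runit_invE tmap_tens id_lfunE.
have -> : L (coev X (1 : K^o)) = R (coev X (1 : K^o)).
  rewrite coev1_homog !linear_sum; apply: eq_bigr => k _.
  rewrite !linear_sum; apply: eq_bigr => i _.
  by rewrite /= LE RE (QE k) ?gproj_mem ?dual_homog.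
rewrite coev1 linear_sum [X in tens y X]dual_expand tens_sumr scaler_sumr.
apply: eq_bigr => i _.
by rewrite /= RE (comp_lfunE _ (phi X h)) tensZr scalerA.
Qed.

(** The mate sends the multiple of (l o phi_(h^-1)) (x) y on the right to y (x) l,
    which determines its inverse. *)
Lemma dual_hb_homog (X : zobj) (Y : gvect) g h (l : gdual X) y :
    l \in gv_comp (gdual X) g^-1%g -> y \in gv_comp Y h ->
  dual_hb X Y (tens y l) = (mate (h * g * h^-1)%g h * theta w g h^-1%g h)^-1 *:
    tens (((l : 'Hom(X, K^o)) \o phi X h^-1%g)%VF : gdual X) y.
Proof.
have E g' h' (m : gdual X) z : m \in gv_comp (gdual X) g'^-1%g -> z \in gv_comp Y h' ->
    dual_hb_inv X Y (tens (((m : 'Hom(X, K^o)) \o phi X h'^-1%g)%VF : gdual X) z) =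
    (mate (h' * g' * h'^-1)%g h' * theta w g' h'^-1%g h') *: tens z m.
  move=> Dm Yz.
  have Dm' : ((m : 'Hom(X, K^o)) \o phi X h'^-1%g)%VF \in
      gv_comp (gdual X) (h' * g' * h'^-1)^-1%g.
    apply/mem_gdual => t v; rewrite invgK => tg Xv.
    rewrite (comp_lfunE _ (phi X h'^-1%g)).
    have /mem_gdual/(_ _ _ _ (phi_mem h'^-1%g Xv)) -> // := Dm.
    rewrite !invgK; apply: contraNneq tg => <-.
    by rewrite !mulgA mulgV mul1g mulgK.
  rewrite (dual_hb_inv_homog Dm' Yz) -scalerA; congr (_ *: _); rewrite -tensZr.
  congr tens; apply: homog_ext => t v Xv.
  rewrite (comp_lfunE _ (phi X h')) (comp_lfunE _ (phi X h'^-1%g)) scale_lfunE.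
  rewrite (phiK h' Xv) linearZ /=.
  have [->//|tg] := eqVneq t g'.
  by have /mem_gdual/(_ t v) -> := Dm; rewrite ?invgK ?scaler0.
have s0 g' h' : mate (h' * g' * h'^-1)%g h' * theta w g' h'^-1%g h' != 0.
  by rewrite mulf_neq0 ?mate_neq0 ?theta_neq0.
have EK : cancel (dual_hb_inv X Y) (dual_hb_inv X Y)^-1%VF.
  apply: (homog_onto_lfunK _ _).1 => [|h' k z m Yz Dm].
    by rewrite dim_tensor mulnC.
  rewrite -[k]invgK in Dm.
  exists ((mate (h' * k^-1 * h'^-1)%g h' * theta w k^-1%g h'^-1%g h')^-1 *:
    tens (((m : 'Hom(X, K^o)) \o phi X h'^-1%g)%VF : gdual X) z).
  by rewrite linearZ /= (E _ _ _ _ Dm Yz) scalerA mulVf ?scale1r.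
move=> Dl Yy; rewrite /dual_hb -[RHS]EK linearZ /= (E _ _ _ _ Dl Yy).
by rewrite scalerA mulVf ?scale1r.
Qed.

(** The trace of phi_x on the component X_g, taken on X in order to make sense
    for every x, whether or not phi_x preserves that component. *)
Definition ctr (X : zobj) (g x : gT) : K := tr (phi X x \o gproj X g)%VF.

Lemma ctr_zrep (X : zobj) g x : x \in 'C[g]%g -> ctr X g x = tr (zrep X g x).
Proof.
move=> Cx; symmetry; apply: tr_restr => [v|v Xv|v Xv]; first exact: gproj_mem.
  exact: gproj_fix.
by rewrite -(cent1_conj Cx) phi_mem.
Qed.

Lemma tr_gproj_phi (X : zobj) g x :
  tr (gproj X g \o phi X x)%VF = if x \in 'C[g]%g then ctr X g x else 0.
Proof.
rewrite trC; case: ifP => // /negbT Cx.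
have -> : (phi X x \o gproj X g = (phi X x \o gproj X g) \o gproj X g)%VF.
  apply/lfunP => v; rewrite !(comp_lfunE _ (gproj X g)).
  by rewrite (gproj_fix (gproj_mem g v)).
rewrite trC (_ : (_ \o _)%VF = 0) ?tr0 //; apply/lfunP => v.
rewrite (comp_lfunE (gproj X g)) (comp_lfunE (phi X x)) zero_lfunE.
rewrite (gproj_id _ (phi_mem x (gproj_mem g v))); case: eqP => // gx.
by case/cent1P: Cx; rewrite /commute {2}gx mulgVK.
Qed.

(** The double braiding is a combination of the operators B g h, each a tensor
    product of an operator of X^* and one of Y; the trace of B g h vanishes
    unless g and h commute. *)
Lemma cattr_braiding (X Y : zobj) :
  cattr nu (V := gdual X ⊗ Y) (dual_hb X Y \o z_hb Y (gdual X))%VF =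
  \sum_g \sum_(h in 'C[g]%g)
    (theta w h g g^-1%g)^-1 * ctr Y h g^-1%g *
    ((theta w g h^-1%g h)^-1 * ctr X g h^-1%g).
Proof.
rewrite cattr_tr.
pose r g h := (mate (h * g * h^-1)%g h * theta w g h^-1%g h)^-1.
pose B g h := (dual_map (gproj X g \o phi X h^-1%g)%VF ⊠
  (gproj Y h \o phi Y g^-1%g)%VF) : 'End(gdual X ⊗ Y).
have BE g h k j (l : gdual X) y : l \in gv_comp (gdual X) k^-1%g ->
    y \in gv_comp Y j -> B g h (tens l y) =
    if (g == k) && (h == k^-1 * j * k^-1^-1)%g then
      tens (((l : 'Hom(X, K^o)) \o phi X h^-1%g)%VF : gdual X) (phi Y k^-1%g y)
    else 0.
  move=> Dl Yy; rewrite /B tmap_tens dual_mapE (comp_lfunE (gproj Y h)).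
  have [->|gk] /= := eqVneq g k; last first.
    rewrite comp_lfunA (_ : (_ \o gproj X g)%VF = 0) ?comp_lfun0l ?tens0l //.
    apply/lfunP => v; rewrite comp_lfunE zero_lfunE.
    have /mem_gdual/(_ g) -> // := Dl; first by rewrite invgK.
    exact: gproj_mem.
  rewrite (gproj_id _ (phi_mem k^-1%g Yy)); case: eqP => _; last by rewrite tens0r.
  congr tens; rewrite comp_lfunA; congr (_ \o _)%VF; apply/lfunP => v.
  rewrite comp_lfunE -[v in RHS]gproj_sum linear_sum (bigD1 k) //=.
  rewrite big1 ?addr0 // => t tk.
  by have /mem_gdual/(_ t) -> // := Dl; rewrite ?invgK ?gproj_mem.
have -> : (dual_hb X Y \o z_hb Y (gdual X))%VF = \sum_g \sum_h r g h *: B g h.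
  apply: homog_tens_ext => k j l y; rewrite -[k]invgK; move: k^-1%g => {}k Dl Yy.
  rewrite comp_lfunE (z_hb_homog y Dl).
  set h0 := (k^-1 * j * k^-1^-1)%g.
  have Yh : phi Y k^-1%g y \in gv_comp Y h0 by exact: phi_mem.
  rewrite (dual_hb_homog Dl Yh).
  rewrite sum_lfunE (bigD1 k) //= [X in _ + X]big1 ?addr0 => [|g gk].
    rewrite sum_lfunE (bigD1 h0) //= [X in _ + X]big1 ?addr0 => [|h hh].
      by rewrite scale_lfunE (BE _ _ _ _ _ _ Dl Yy) !eqxx.
    by rewrite scale_lfunE (BE _ _ _ _ _ _ Dl Yy) (negPf hh) andbF scaler0.
  rewrite sum_lfunE big1 // => h _.
  by rewrite scale_lfunE (BE _ _ _ _ _ _ Dl Yy) (negPf gk) scaler0.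
rewrite tr_sum; apply: eq_bigr => g _; rewrite tr_sum [RHS]big_mkcond.
apply: eq_bigr => h _; rewrite trZ tr_tmap tr_dual_map !tr_gproj_phi groupV.
case: ifP => Ch; last by rewrite mul0r mulr0.
have Cg : g \in 'C[h]%g by rewrite cent1C.
rewrite groupV Cg /r (cent1_conj (a := g) Ch) mate_comm; last exact/cent1P.
by rewrite invfM; ring.
Qed.

(** Conjugation by phi_c moves the trace from X_g to X_a.  The numerator collects
    the scalars of phi_c phi_h phi_(c^-1), the denominator that of
    phi_(c^-1) phi_c. *)
Lemma ctr_conj (X : zobj) (a c g h : gT) : a = (c * g * c^-1)%g -> h \in 'C[g]%g ->
  ctr X g h = theta w a c h * theta w a (c * h)%g c^-1%g / theta w g c^-1%g c *
    ctr X a (c * h * c^-1)%g.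
Proof.
move=> ac Ch.
have ca : (c^-1 * a * c = g)%g by rewrite ac !mulgA mulVg mul1g mulgVK.
have cha : (c * h * g * (c * h)^-1 = a)%g.
  by rewrite ac -(mulgA c) (cent1P Ch) invMg !mulgA mulgK.
have chca : (c * h * c^-1 * a * (c * h * c^-1)^-1 = a)%g.
  by rewrite -[RHS]cha ac !invMg invgK !mulgA !mulgVK.
pose s := theta w a c h * theta w a (c * h)%g c^-1%g.
have E1 : (phi X c \o (phi X h \o (phi X c^-1%g \o gproj X a)))%VF =
    s *: (phi X (c * h * c^-1)%g \o gproj X a)%VF.
  apply/lfunP => v; rewrite scale_lfunE !(comp_lfunE _ (gproj X a)).
  rewrite (comp_lfunE (phi X c)) (comp_lfunE (phi X h)).
  rewrite (comp_lfunE (phi X c^-1%g)).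
  have Xa := gproj_mem a v; have := phi_mem c^-1%g Xa; rewrite invgK ca => Xg.
  by rewrite (phiM c h Xg) cha (phiM (c * h)%g c^-1%g Xa) chca scalerA.
have E2 : ((phi X h \o (phi X c^-1%g \o gproj X a)) \o phi X c)%VF =
    theta w g c^-1%g c *: (phi X h \o gproj X g)%VF.
  apply/lfunP => v; rewrite scale_lfunE (comp_lfunE _ (phi X c)).
  rewrite !(comp_lfunE (phi X h)) (comp_lfunE (phi X c^-1%g)).
  by rewrite {1}ac -phi_gproj (phiK c (gproj_mem g v)) linearZ.
apply: (mulfI (theta_neq0 g c^-1%g c)).
rewrite [LHS](_ : _ = s * ctr X a (c * h * c^-1)%g).
  by rewrite mulrA mulrCA mulfV ?mulr1 ?theta_neq0.
by rewrite /ctr -!trZ -E1 -E2 trC.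
Qed.

Lemma ctr_character (X : zobj) (a c g h : gT) (V : vectType K)
    (rho : gT -> 'End(V)) :
    a = (c * g * c^-1)%g -> h \in 'C[g]%g ->
    proj_equiv 'C[a]%g (zrep X a) rho ->
  ctr X g h = theta w a c h * theta w a (c * h)%g c^-1%g / theta w g c^-1%g c *
    character rho (c * h * c^-1)%g.
Proof.
move=> ac Ch Xrho; rewrite (ctr_conj X ac Ch).
have Ca : (c * h * c^-1)%g \in 'C[a]%g.
  apply/cent1P; rewrite /commute ac !mulgA !mulgVK.
  by rewrite -(mulgA c g) -(cent1P Ch) !mulgA.
by rewrite (ctr_zrep X Ca) -(proj_equiv_character Xrho Ca).
Qed.

End Center.

(** * The T and S matrices *)

Section ModularData.
Variables (K : numClosedFieldType) (gT : finGroupType) (w : gT -> gT -> gT -> K).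
Hypotheses (w_cocycle : cocycle3 w) (w_norm : normalized3 w).
Hypothesis w_norm1 : forall x y z, `|w x y z| = 1.
Notation zobj := (zobj (inv3 w)).

Lemma theta_norm1 g x y : `|theta w g x y| = 1.
Proof. by rewrite /theta !normrM normfV !w_norm1 invr1 !mulr1. Qed.

Lemma ctr_inv (X : zobj) g x : x \in 'C[g]%g ->
  (theta w g x x^-1%g)^-1 * ctr X g x^-1%g = (ctr X g x)^*.
Proof.
move=> Cx; have CV : x^-1%g \in 'C[g]%g by rewrite groupV.
have Xg := zrep_repr w_cocycle w_norm X g; have [_ zM] := Xg.
rewrite !(ctr_zrep w_cocycle w_norm) // -trZ.
apply: (proj_repr_trV (H := 'C[g]%G) (theta_norm1 g) Xg) => //.
rewrite -comp_lfunZr zM // mulgV (zrep1 w_cocycle w_norm) scalerA.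
by rewrite mulVf ?scale1r ?(theta_neq0 w_cocycle).
Qed.

(** The two scalars in the trace of the double braiding are those for which
    phi_(g^-1) and phi_(h^-1) become inverses, whose traces are conjugates. *)
Lemma Smatrix_ctr (X Y : zobj) : Smatrix X Y =
  #|gT|%:R^-1 * \sum_g \sum_(h in 'C[g]%g) (ctr X g h)^* * (ctr Y h g)^*.
Proof.
rewrite /Smatrix (cattr_braiding w_cocycle w_norm); congr (_ * _).
apply: eq_bigr => g _; apply: eq_bigr => h Ch.
have <- : theta w g h h^-1%g = theta w g h^-1%g h.
  by apply: (theta_inv w_cocycle w_norm); exact/cent1P.
by rewrite !ctr_inv // 1?cent1C // mulrC.
Qed.

Lemma ctr_out (X : zobj) (A : {set gT}) g h : zsupported X A -> g \notin A ->
  ctr X g h = 0.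
Proof.
move=> suppX /suppX X0; rewrite /ctr (_ : (_ \o _)%VF = 0) ?tr0 //.
apply/lfunP => v; rewrite comp_lfunE zero_lfunE.
by have := gproj_mem g v; rewrite X0 memv0 => /eqP->; rewrite linear0.
Qed.

(** An eigenspace of the twist is a nonzero subobject. *)
Lemma twist_scalar (X : zobj) : zsimple X -> exists k, twist X = k *: \1%VF.
Proof.
move=> /(zsimpleP w_cocycle w_norm)[X0 simX].
have [k [v [v0 tv]]] := lfun_eigenvector (twist X) X0.
have /zmorP[tg tphi] := twist_zmor w_cocycle w_norm X.
have st : stable (lker (twist X - k *: \1)%VF).
  move=> u; rewrite memv_ker add_lfunE opp_lfunE scale_lfunE id_lfunE subr_eq0.
  move=> /eqP tu; split=> [g|x];
    rewrite memv_ker add_lfunE opp_lfunE scale_lfunE id_lfunE subr_eq0.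
    by rewrite (gmor_gproj _ _ tg) tu linearZ.
  by rewrite tphi tu linearZ.
exists k; have [E|E] := simX _ st.
  have : v \in lker (twist X - k *: \1)%VF.
    by rewrite memv_ker add_lfunE opp_lfunE scale_lfunE id_lfunE tv subrr.
  by rewrite E memv0 (negPf v0).
apply/lfunP => u; have : u \in lker (twist X - k *: \1)%VF by rewrite E memvf.
by rewrite memv_ker add_lfunE opp_lfunE scale_lfunE subr_eq0 => /eqP.
Qed.

Lemma twist_character (X : zobj) a (V : vectType K) (rho : gT -> 'End(V)) :
    zsimple X -> zsupported X (a ^: [set: gT])%g ->
    proj_equiv 'C[a]%g (zrep X a) rho ->
  twist X = (character rho a / character rho 1%g) *: \1%VF.
Proof.
move=> sX suppX Xrho; have [k kE] := twist_scalar sX; rewrite kE.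
have [Xa0 _] := (zsimple_irr w_cocycle w_norm suppX).1 sX.
have Ca : a \in 'C[a]%g by apply/cent1P.
rewrite -!(proj_equiv_character Xrho) ?group1 // /character.
have -> : zrep X a a = k *: \1%VF.
  apply/lfunP => v; apply: subvs_inj; rewrite (zrep_val w_cocycle w_norm) //.
  rewrite -(twist_homog w_cocycle w_norm (subvsP v)) kE !scale_lfunE !id_lfunE.
  by rewrite linearZ.
rewrite (zrep1 w_cocycle w_norm) trZ mulfK // tr1 pnatr_eq0 dimv_eq0; exact/eqP.
Qed.

End ModularData.

(** * The classification and the modular data *)

Theorem theorem2p1 (R : realType) (gT : finGroupType)
    (omega : gT -> gT -> gT -> R[i])
    (omega_cocycle : cocycle3 omega)
    (omega_normalized : normalized3 omega)
    (omega_norm1 : forall x y z, `|omega x y z| = 1)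
    (a : {set gT} -> gT)
    (a_rep : forall K, K \in classes [set: gT] -> a K \in K)
    (c : {set gT} -> gT -> gT)
    (c_conj : forall K g, K \in classes [set: gT] -> g \in K ->
       a K = (c K g * g * (c K g)^-1)%g) :
  let Z := zobj (inv3 omega) in
  let th := theta omega in
  [/\ (* simple objects up to isomorphism <-> triples up to equivalence *)
      [/\ forall X : Z, zsimple X ->
            exists t, is_triple a omega t /\ attached a X t,
          forall t, is_triple a omega t ->
            exists X : Z, zsimple X /\ attached a X t
        & forall (X Y : Z) (s t : triple R[i] gT),
            zsimple X -> zsimple Y -> is_triple a omega s -> is_triple a omega t ->
            attached a X s -> attached a Y t ->
            (ziso X Y <-> triple_equiv a s t)],
      (* the entries of T *)
      forall (X Y : Z) (K L : {set gT}) (V W : vectType R[i])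
          (rho : gT -> 'End(V)) (psi : gT -> 'End(W)),
        zsimple X -> zsimple Y ->
        is_triple a omega (Triple K rho) -> is_triple a omega (Triple L psi) ->
        attached a X (Triple K rho) -> attached a Y (Triple L psi) ->
        is_Tentry X Y
          ((K == L)%:R * `[< proj_equiv 'C[a K]%g rho psi >]%:R *
           (character rho (a K) / character rho 1%g))
    & (* the entries of S *)
      forall (X Y : Z) (K L : {set gT}) (V W : vectType R[i])
          (rho : gT -> 'End(V)) (psi : gT -> 'End(W)),
        zsimple X -> zsimple Y ->
        is_triple a omega (Triple K rho) -> is_triple a omega (Triple L psi) ->
        attached a X (Triple K rho) -> attached a Y (Triple L psi) ->
        Smatrix X Y =
          #|gT|%:R^-1 *
          \sum_(g in K) \sum_(h in L :&: 'C[g]%g)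
            (th (a K) (c K g) h * th (a K) (c K g * h)%g (c K g)^-1%g *
             th (a L) (c L h) g * th (a L) (c L h * g)%g (c L h)^-1%g /
             (th g (c K g)^-1%g (c K g) * th h (c L h)^-1%g (c L h)))^* *
            (character rho (c K g * h * (c K g)^-1)%g)^* *
            (character psi (c L h * g * (c L h)^-1)%g)^*].
Proof.
move=> Z th.
have C0 (x : gT) : #|'C[x]%g|%:R != 0 :> R[i] by rewrite pnatr_eq0 -lt0n cardG_gt0.
have aE A : A \in classes [set: gT] -> A = (a A ^: [set: gT])%g.
  by move=> cA; apply: classes_class (a_rep _ cA).
split; first split.
- exact: zsimple_triple.
- exact: triple_zsimple.
- by move=> X Y s t; exact: attached_ziso.
- move=> X Y A B V W rho psi sX sY tX tY aX aY.
  have XY := attached_ziso omega_cocycle omega_normalized a_rep C0 sX sY tX tY aX aY.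
  have [[/= cA _ _] [/= suppX Xrho]] := (tX, aX).
  split=> [/XY[/= AB rhopsi]|nXY].
    rewrite AB eqxx -AB (asboolT rhopsi) !mul1r.
    by apply: twist_character; rewrite -?aE.
  have [AB|_] := eqVneq A B; last by rewrite !mul0r.
  rewrite asboolF ?mulr0 ?mul0r // => rhopsi.
  by apply: nXY; apply/XY.
move=> X Y A B V W rho psi sX sY tX tY [/= suppX Xrho] [/= suppY Ypsi].
have [[/= cA _ _] [/= cB _ _]] := (tX, tY).
rewrite (Smatrix_ctr omega_cocycle omega_normalized omega_norm1); congr (_ * _).
rewrite [RHS]big_mkcond; apply: eq_bigr => g _ /=.
case: ifP => [Ag|/negbT Ag]; last first.
  by rewrite big1 // => h _; rewrite (ctr_out _ suppX Ag) rmorph0 mul0r.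
rewrite big_mkcond [RHS]big_mkcond; apply: eq_bigr => h _ /=.
rewrite in_setI; have [Ch|Ch] := boolP (h \in 'C[g]%g); last by rewrite andbF.
have [Bh|Bh] /= := boolP (h \in B); last first.
  by rewrite (ctr_out _ suppY Bh) rmorph0 mulr0.
have Cg : g \in 'C[h]%g by rewrite cent1C.
rewrite (ctr_character omega_cocycle omega_normalized (c_conj A g cA Ag) Ch Xrho).
rewrite (ctr_character omega_cocycle omega_normalized (c_conj B h cB Bh) Cg Ypsi).
by rewrite -!rmorphM; congr (_^*); rewrite /th [in RHS]invfM; ring.
Qed.
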